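(* For any admissible index $\mathbf{k}$, \[ Z_{q}\Bigl(g_{\mathbf{k}}\,\frac{1}{1-g_{1}X}\Bigr) \equiv \exp{\Bigl( \sum_{n\ge 2} \frac{(-1)^{n-1}}{n}Z_{q}(g_{n})X^{n}\Bigr)}\, Z_{q}\bigl(E_{\mathbf{k}} \exp_{\mathrm{sh}_{\hbar}}(g_{1}X) \bigr) \] in $\widehat{\mathcal{Z}_{q}}[[X]]$ modulo $\mathcal{N}_{q}[[X]]$.
   Context: Let $\mathcal{C}=\mathbb{Q}[\hbar]$ ($\hbar$ formal), $\mathfrak{H}=\mathcal{C}\langle a,b\rangle$ (non-commutative polynomials). For $k\ge1$ put $g_k=ba^k$, $e_k=b(a+\hbar)a^{k-1}$. Let $A=\{\hbar b\}\cup\{ba^k\mid k\ge1\}$, $\mathcal{C}\langle A\rangle$ the $\mathcal{C}$-subalgebra generated by $1$ and $A$, $\mathfrak z$ the $\mathcal C$-span of $A$, $\widehat{\mathfrak H^0}=\mathcal C+\sum_{k\ge1}\mathcal C\langle A\rangle g_k$. Fix $q\in\mathbb{C}$, $0<|q|<1$; $\mathbb{C}$ is a $\mathcal{C}$-module with $\hbar$ acting by $1-q$; $[m]=(1-q^m)/(1-q)$; $F_q(m;\cdot):\mathfrak{z}\to\mathbb{C}$ is $\mathcal{C}$-linear with $F_q(m;\hbar b)=1-q$, $F_q(m;g_k)=q^{km}/[m]^k$; $Z_{q,M}:\mathcal{C}\langle A\rangle\to\mathbb{C}$ is $\mathcal{C}$-linear with $Z_{q,M}(1)=1$, $Z_{q,M}(u_1\cdots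 u_r)=\sum_{0<m_1<\cdots<m_r<M}\prod_i F_q(m_i;u_i)$ ($u_i\in A$); for $w\in\widehat{\mathfrak H^0}$, $Z_q(w)=\lim_{M\to\infty}Z_{q,M}(w)$ (it exists). $\widehat{\mathcal Z_q}=Z_q(\widehat{\mathfrak H^0})$ is a ring. The shuffle product $\mathrm{sh}_\hbar$ on $\mathfrak H$ is $\mathcal C$-bilinear with $w\,\mathrm{sh}_\hbar\,1=1\,\mathrm{sh}_\hbar\,w=w$, $wa\,\mathrm{sh}_\hbar\,w'a=(wa\,\mathrm{sh}_\hbar\,w'+w\,\mathrm{sh}_\hbar\,w'a+\hbar(w\,\mathrm{sh}_\hbar\,w'))a$, $wb\,\mathrm{sh}_\hbar\,w'=w\,\mathrm{sh}_\hbar\,w'b=(w\,\mathrm{sh}_\hbar\,w')b$. For $f(X)$ with $f(0)=0$, $\exp_{\mathrm{sh}_\hbar}(f(X))=1+\sum_{n\ge1}\frac1{n!}f(X)^{\mathrm{sh}_\hbar n}$ (the $n$-fold $\mathrm{sh}_\hbar$-product). Indices: finite tuples $\mathbf k=(k_1,\dots,k_r)$ of positive integers, admissible if empty or $k_r\ge2$; $g_{\mathbf k}=g_{k_1}\cdots g_{k_r}$, $g_\varnothing=1$. For $m\ge0$, $E_{1^m}=\frac1{(m+1)!}\sum_{j=0}^m g_1^{\mathrm{sh}_\hbar j}\,\mathrm{sh}_\hbar\,e_1^{\mathrm{sh}_\hbar(m-j)}$. Writing a non-empty index uniquely as $(1^{s_0},t_1+2,1^{s_1},\dots,t_r+2,1^{s_r})$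 ($r,s_i,t_i\ge0$, $1^s$ = $s$ ones), $E_{\mathbf k}=E_{1^{s_0}}e_{t_1+2}E_{1^{s_1}}\cdots e_{t_r+2}E_{1^{s_r}}$; $E_\varnothing=1$. Let $\mathfrak n_0$ be the $\mathcal C$-span of the elements $(\hbar b)^{\alpha_1}g_{\beta_1+1}\cdots(\hbar b)^{\alpha_r}g_{\beta_r+1}$ with $r\ge1$, $\alpha_i,\beta_i\ge0$, such that $\alpha_s\ge1$ and $\beta_t\ge1$ for some $1\le s\le t\le r$; $\mathfrak n=\mathfrak n_0+\hbar\widehat{\mathfrak H^0}$; $\mathcal N_q=Z_q(\mathfrak n)$, an ideal of $\widehat{\mathcal Z_q}$. $Z_q$ is applied to formal power series coefficientwise; $\frac{1}{1-g_1X}=\sum_{n\ge0}g_1^nX^n$. *)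

(* Defs.v *)
From HB Require Import structures.
From mathcomp Require Import all_boot all_order all_algebra.
From mathcomp Require Import complex.
From mathcomp Require Import all_classical all_reals all_analysis.
Import numFieldNormedType.Exports.
Import Order.TTheory GRing.Theory Num.Theory.

Set Implicit Arguments.
Unset Strict Implicit.
Unset Printing Implicit Defensive.

Local Open Scope classical_set_scope.
Local Open Scope ring_scope.

(* The algebra  H = C<a,b>,  C = Q[hbar]  (hbar = 'X of {poly rat}).   *)
(* An element is represented as a finite formal sum of monomials      *)
(* (coefficient, word); all maps below (concatenation product,        *)
(* shuffle product, Z_{q,M}) are defined monomial-wise and are        *)
(* C-(bi)linear, hence independent of the chosen representation.      *)
Inductive letter := La | Lb.

Definition word := seq letter.
Definition hpoly := seq ({poly rat} * word).

Definition hone : hpoly := [:: (1, [::])].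
Definition hzero : hpoly := [::].
Definition hadd (p r : hpoly) : hpoly := p ++ r.
Definition hscale (c : {poly rat}) (p : hpoly) : hpoly :=
  [seq (c * x.1, x.2) | x <- p].
Definition hmul (p r : hpoly) : hpoly :=
  [seq (x.1 * y.1, x.2 ++ y.2) | x <- p, y <- r].
Definition hsum (ps : seq hpoly) : hpoly := foldr hadd hzero ps.

(* g_k = b a^k,  e_k = b (a + hbar) a^(k-1)  (k >= 1) *)
Definition g (k : nat) : hpoly := [:: (1, Lb :: nseq k La)].
Definition e (k : nat) : hpoly :=
  [:: (1, Lb :: nseq k La); ('X, Lb :: nseq k.-1 La)].

(* Shuffle product sh_hbar on words, computed on REVERSED words
   (the head of the list is the last letter):
     w sh 1 = 1 sh w = w,
     wa sh w'a = (wa sh w' + w sh w'a + hbar (w sh w')) a,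
     wb sh w' = w sh w'b = (w sh w') b. *)
Definition happ_letter (l : letter) (p : hpoly) : hpoly :=
  [seq (x.1, l :: x.2) | x <- p].

Fixpoint rsh (u : word) : word -> hpoly :=
  match u with
  | [::] => fun v => [:: (1, v)]
  | x :: u' =>
    fix rshu (v : word) : hpoly :=
      match v with
      | [::] => [:: (1, x :: u')]
      | y :: v' =>
        match x, y with
        | Lb, _ => happ_letter Lb (rsh u' v)
        | La, Lb => happ_letter Lb (rshu v')
        | La, La =>
          happ_letter La (rshu v' ++ rsh u' v ++ hscale 'X (rsh u' v'))
        end
      end
  end.

Definition sh (p r : hpoly) : hpoly :=
  flatten [seq [seq (x.1 * y.1 * z.1, rev z.2) | z <- rsh (rev x.2) (rev y.2)]
          | x <- p, y <- r].

Definition shpow (p : hpoly) (n : nat) : hpoly := iter n (sh p) hone.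
Definition hpow (p : hpoly) (n : nat) : hpoly := iter n (hmul p) hone.

Definition admissible (ks : seq nat) : bool :=
  all (fun k => 0 < k)%N ks && ((ks == [::]) || (2 <= last 0 ks)%N).

Definition gk (ks : seq nat) : hpoly := foldr (fun k p => hmul (g k) p) hone ks.

Definition E1 (m : nat) : hpoly :=
  hscale (((m.+1)`!%:R)^-1 : rat)%:P
    (hsum [seq sh (shpow (g 1) j) (shpow (e 1) (m - j)) | j <- iota 0 m.+1]).

(* E_{(1^{s0}, t1+2, 1^{s1}, ..., tr+2, 1^{sr})}
     = E_{1^{s0}} e_{t1+2} E_{1^{s1}} ... e_{tr+2} E_{1^{sr}};
   Ego s ks handles a pending run of s ones. *)
Fixpoint Ego (s : nat) (ks : seq nat) : hpoly :=
  match ks with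
  | [::] => E1 s
  | k :: ks' => if k == 1%N then Ego s.+1 ks'
                else hmul (hmul (E1 s) (e k)) (Ego 0 ks')
  end.
Definition Ek (ks : seq nat) : hpoly := Ego 0 ks.

(* Parsing a word  a^n b a^{k1} b a^{k2} ... b a^{kr}  into (n, [k1..kr]) *)
Definition wparse (w : word) : nat * seq nat :=
  foldr (fun l st => match l with
                     | La => (st.1.+1, st.2)
                     | Lb => (0%N, st.1 :: st.2)
                     end) (0%N, [::]) w.

Section Zq.
Variable R : realType.
Local Notation C := ((R[i])^o).
Variable q : R[i].

Definition qint (m : nat) : C := (1 - (q : C) ^+ m) / (1 - (q : C)).

(* F_q(m; b a^k) without the hbar-factor: q^{km}/[m]^k  (k = 0 gives 1;
   F_q(m; hbar b) = 1 - q = (value of hbar) * 1). *)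
Definition Fq (m k : nat) : C := ((q : C) ^+ m / qint m) ^+ k.

(* sum_{0 < m_1 < ... < m_r < M} prod_i F(m_i, k_i), ks given reversed *)
Fixpoint Ssum (rks : seq nat) (M : nat) : C :=
  match rks with
  | [::] => 1
  | k :: rks' => \sum_(1 <= m < M) Ssum rks' m * Fq m k
  end.

Definition hev (c : {poly rat}) : C := (map_poly (fun r : rat => ratr r : C) c).[1 - (q : C)].

(* Z_{q,M} on a monomial c * b a^{k1} ... b a^{kr}:
     c(1-q) * sum_{0<m_1<...<m_r<M} prod_i q^{k_i m_i}/[m_i]^{k_i}.
   On C<A> this is exactly the paper's Z_{q,M}
   (hbar^j (ba^0 factors) contribute (1-q) each). *)
Definition ZqM_mono (M : nat) (x : {poly rat} * word) : C :=
  let st := wparse x.2 in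
  if st.1 == 0%N then hev x.1 * Ssum (rev st.2) M else 0.

Definition ZqM (M : nat) (p : hpoly) : C := \sum_(x <- p) ZqM_mono M x.

Definition Zq (p : hpoly) : C := limn (fun M => ZqM M p).

(* monomials spanning n_0:  c * (hbar b)^{al_1} g_{be_1+1} ... with
   some al_s >= 1, be_t >= 1, s <= t; as a word b a^{k_1} ... b a^{k_r}
   with k_r >= 1, coefficient divisible by hbar^{#{i | k_i = 0}}, and
   some i < j with k_i = 0 and k_j >= 2. *)
Definition n0_mono (x : {poly rat} * word) : bool :=
  let st := wparse x.2 in
  let ks := st.2 in
  [&& st.1 == 0%N, ks != [::], (1 <= last 0 ks)%N,
      ('X ^+ (count (pred1 0%N) ks) %| x.1)%R &
      [exists i : 'I_(size ks), exists j : 'I_(size ks),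
         [&& (i < j)%N, nth 0%N ks i == 0%N & (2 <= nth 0%N ks j)%N]]].

(* monomials spanning hbar * H^0hat,  H^0hat = C + sum_k C<A> g_k *)
Definition hH0_mono (x : {poly rat} * word) : bool :=
  let st := wparse x.2 in
  let ks := st.2 in
  [&& st.1 == 0%N, (ks == [::]) || (1 <= last 0 ks)%N &
      ('X ^+ (count (pred1 0%N) ks).+1 %| x.1)%R].

Definition n_mono (x : {poly rat} * word) : bool := n0_mono x || hH0_mono x.

Definition Nq : set C := [set z | exists p : hpoly, all n_mono p /\ z = Zq p].

Definition ps_mul (A B : nat -> C) (N : nat) : C :=
  \sum_(i < N.+1) A i * B (N - i)%N.
Definition ps_pow (A : nat -> C) (j : nat) : nat -> C :=
  iter j (ps_mul A) (fun N => (N == 0%N)%:R).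
(* exp of a series with zero constant term *)
Definition ps_exp (A : nat -> C) (N : nat) : C :=
  \sum_(j < N.+1) (j`!%:R)^-1 * ps_pow A j N.

Definition Pser (n : nat) : C :=
  if (2 <= n)%N then (-1) ^+ n.-1 / n%:R * Zq (g n) else 0.

Definition lhs_ser (ks : seq nat) (n : nat) : C := Zq (hmul (gk ks) (hpow (g 1) n)).

Definition Eexp_ser (ks : seq nat) (n : nat) : C :=
  Zq (hmul (Ek ks) (hscale ((n`!%:R)^-1 : rat)%:P (shpow (g 1) n))).

Definition rhs_ser (ks : seq nat) : nat -> C := ps_mul (ps_exp Pser) (Eexp_ser ks).

End Zq.

(* Main.v *)
(* Attach to a word w the power series I_w(t) with Z_q(w) = I_w(1), on which the
   letter b acts as multiplication by t/(1-t) and the letter a as the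
   Rota-Baxter operator P : t^m |-> q^m/[m] t^m, so that sh_hbar is the product
   of power series.  Put h = 1 - q, L = P(b), A_1 = 1/(1 - g_1 X) and
   A_2 = exp(X L).  For a nonempty admissible k, I_{g_k} = P f, and
     g_k 1/(1 - g_1 X)     gives  A_1 P(f c_1),  c_1 = 1/(A_1 (1 + h X b)),
     g_k exp_sh(g_1 X)     gives  A_2 P(f c_2),  c_2 = exp(-X (L + h b)).
   Newton's identities give Z(A_1) = exp(sum_{n>=2} ...) Z(A_2).  The
   coefficients of c_1 - c_2 are multiples of h in the shuffle algebra C<A>, and
   P sends the products of f with such multiples to n, because a word containing
   h b then ends in g_k with k >= 2 or has a further factor h.  In the same way
   E_{1^s} is g_1^s modulo h, so that E_k may be replaced by g_k.  Finally N_q is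
   stable under multiplication by the Z_q(g_n), by the harmonic product. *)
Require Import Defs.
From HB Require Import structures.
From mathcomp Require Import all_boot all_order all_algebra.
From mathcomp Require Import complex.
From mathcomp Require Import ring lra zify.
From mathcomp Require Import all_classical all_reals all_analysis.
Import numFieldNormedType.Exports.
Import Order.TTheory GRing.Theory Num.Theory.
Local Open Scope classical_set_scope.
Local Open Scope ring_scope.

Set Implicit Arguments.
Unset Strict Implicit.
Unset Printing Implicit Defensive.

(** The statement mixes two products: Newton's identities belong to the harmonic product, the
    factorisations over A_1 and A_2 to sh_hbar. They meet only after Z_q has been taken, where both
    become multiplication of numbers; as power series in t, A_1 and A_2 are only shown to agree
    modulo hbar. Divisibility by hbar is understood in C<a,b>, so that the letter hbar b counts as
    divisible although it is not hbar times an element of C<A>. For this reason a multiple of hbar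
    in C<A> need not lie in n: its words may end in hbar b, or have only g_1's after hbar b. Writing
    g_k as P f repairs this, because P lengthens the last block of every word in a product with
    f. *)

Definition fps (K : Type) := nat -> K.

(** * Formal power series *)

Section FpsRing.
Variable K : comNzRingType.
Implicit Types f g h : fps K.

HB.instance Definition _ := GRing.Zmodule.copy (fps K) (nat -> K).

Definition fps_one : fps K := fun n => (n == 0%N)%:R.
Definition fps_mul f g : fps K := fun n => \sum_(i < n.+1) f i * g (n - i)%N.

(* Coefficients of index below n.+1 only depend on truncations, so the ring
   laws are inherited from {poly K}. *)
Let trunc n f : {poly K} := \poly_(i < n.+1) f i.

Let fps_mul_trunc n m f g : (m <= n)%N ->
  fps_mul f g m = (trunc n f * trunc n g)`_m.
Proof.
move=> lemn; rewrite coefM; apply: eq_bigr => i _.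
have lein : (i <= n)%N by apply: leq_trans lemn; rewrite -ltnS.
have lemin : (m - i <= n)%N by apply: leq_trans (leq_subr _ _) lemn.
by rewrite !coef_poly !ltnS lein lemin.
Qed.

Let coef_trunc n m f : (m <= n)%N -> (trunc n f)`_m = f m.
Proof. by move=> lemn; rewrite coef_poly ltnS lemn. Qed.

Let fps_mulC : commutative fps_mul.
Proof.
move=> f g; apply/funext => n.
by rewrite !(@fps_mul_trunc n n) // mulrC.
Qed.

Let fps_mulA : associative fps_mul.
Proof.
move=> f g h; apply/funext => n.
transitivity ((trunc n f * (trunc n g * trunc n h))`_n).
  rewrite coefM; apply: eq_bigr => i _.
  have lein : (i <= n)%N by rewrite -ltnS.
  by rewrite coef_trunc // -fps_mul_trunc // leq_subr.
rewrite mulrA coefM; apply: eq_bigr => i _.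
have lein : (i <= n)%N by rewrite -ltnS.
by rewrite coef_trunc ?leq_subr // -fps_mul_trunc.
Qed.

Let fps_mul1 : left_id fps_one fps_mul.
Proof.
move=> f; apply/funext => n; rewrite /fps_mul big_ord_recl /= subn0 mul1r.
by rewrite big1 ?addr0 // => i _; rewrite /fps_one /= mul0r.
Qed.

Let fps_mulDl : left_distributive fps_mul +%R.
Proof.
move=> f g h; apply/funext => n; rewrite /fps_mul /GRing.add /= -big_split /=.
by apply: eq_bigr => i _; rewrite mulrDl.
Qed.

Let fps_one_neq0 : fps_one != 0 :> fps K.
Proof.
by apply/eqP => /(congr1 (fun f : fps K => f 0%N)) /eqP; rewrite /fps_one /= oner_eq0.
Qed.

HB.instance Definition _ := GRing.Zmodule_isComNzRing.Build (fps K)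
  fps_mulA fps_mulC fps_mul1 fps_mulDl fps_one_neq0.

Lemma fpsME f g n : (f * g) n = \sum_(i < n.+1) f i * g (n - i)%N.
Proof. by []. Qed.
Lemma fps1E n : (1 : fps K) n = (n == 0%N)%:R. Proof. by []. Qed.
Lemma fps0E n : (0 : fps K) n = 0. Proof. by []. Qed.
Lemma fpsDE f g n : (f + g) n = f n + g n. Proof. by []. Qed.
Lemma fpsNE f n : (- f) n = - f n. Proof. by []. Qed.
Lemma fpsBE f g n : (f - g) n = f n - g n. Proof. by []. Qed.
Lemma fps_sumE I (r : seq I) (Q : pred I) (F : I -> fps K) n :
  (\sum_(i <- r | Q i) F i) n = \sum_(i <- r | Q i) F i n.
Proof. by elim/big_ind2: _ => // x1 x2 y1 y2 <- <-. Qed.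
Lemma fpsMnE f k n : (f *+ k) n = f n *+ k.
Proof. by elim: k => // k IH; rewrite !mulrS fpsDE IH. Qed.

Definition fpsC (c : K) : fps K := fun n => if n == 0%N then c else 0.

Lemma fpsCM c f n : (fpsC c * f) n = c * f n.
Proof.
rewrite fpsME big_ord_recl /= subn0 big1 ?addr0 // => i _.
by rewrite /fpsC /= mul0r.
Qed.

Lemma fpsC_is_additive : {morph fpsC : x y / x - y}.
Proof. by move=> x y; apply/funext => -[|n]; rewrite fpsBE /fpsC //= subrr. Qed.
Lemma fpsC_is_monoid : monoid_morphism fpsC.
Proof.
split=> [|x y]; first by apply/funext => -[].
by apply/funext => n; rewrite fpsCM /fpsC; case: (n == 0%N); rewrite ?mulr0.
Qed.
HB.instance Definition _ := GRing.isZmodMorphism.Build K (fps K) fpsC fpsC_is_additive.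
HB.instance Definition _ := GRing.isMonoidMorphism.Build K (fps K) fpsC fpsC_is_monoid.

Definition fpsX : fps K := fun n => (n == 1%N)%:R.

Lemma fpsXM0 f : (fpsX * f) 0%N = 0.
Proof. by rewrite fpsME big_ord1 /= /fpsX mul0r. Qed.
Lemma fpsXMS f n : (fpsX * f) n.+1 = f n.
Proof.
rewrite fpsME !big_ord_recl /= /fpsX mul0r add0r /= mul1r subn1 /= big1 ?addr0 //.
by move=> i _; rewrite /bump /= mul0r.
Qed.

Definition fps_deriv f : fps K := fun n => f n.+1 *+ n.+1.

Lemma fps_derivD f g : fps_deriv (f + g) = fps_deriv f + fps_deriv g.
Proof. by apply/funext => n; rewrite /fps_deriv !fpsDE mulrnDl. Qed.

Lemma fps_derivM f g : fps_deriv (f * g) = fps_deriv f * g + f * fps_deriv g.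
Proof.
apply/funext => n; rewrite /fps_deriv fpsDE !fpsME.
transitivity (\sum_(i < n.+2) (f i * g (n.+1 - i)%N *+ i +
                               f i * g (n.+1 - i)%N *+ (n.+1 - i))).
  rewrite -sumrMnl; apply: eq_bigr => i _.
  by rewrite -mulrnDr subnKC // -ltnS.
rewrite big_split /=; congr (_ + _).
  rewrite big_ord_recl mulr0n add0r; apply: eq_bigr => i _ /=.
  by rewrite /bump /= add1n subSS mulrnAl.
rewrite big_ord_recr /= subnn mulr0n addr0; apply: eq_bigr => i _.
have lein : (i <= n)%N by rewrite -ltnS.
by rewrite subSn // mulrnAr.
Qed.

Lemma fps_deriv1 : fps_deriv 1 = 0.
Proof. by apply/funext => n; rewrite /fps_deriv fps1E mul0rn. Qed.

Lemma fps_derivX f n : fps_deriv (f ^+ n.+1) = fps_deriv f * f ^+ n *+ n.+1.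
Proof.
elim: n => [|n IH]; first by rewrite expr0 mulr1 expr1.
by rewrite exprS fps_derivM IH mulrnAr mulrCA -exprS -mulrS.
Qed.

Lemma fpsX_lt f j n : f 0%N = 0 -> (n < j)%N -> (f ^+ j) n = 0.
Proof.
move=> f0; elim: j n => [//|j IH] n ltnj; rewrite exprS fpsME.
apply: big1 => -[[|i] /= ltin] _; first by rewrite f0 mul0r.
by rewrite IH ?mulr0 //; lia.
Qed.

(** The geometric series of [1 - f]. When [f 0 = 1], the power [(1 - f) ^+ j] has no coefficient
    below [j], so cutting the sum at [n] loses nothing. *)
Definition fps_inv f : fps K := fun n => \sum_(j < n.+1) ((1 - f) ^+ j) n.

Lemma fps_invE f n k : f 0%N = 1 -> (k <= n)%N ->
  fps_inv f k = (\sum_(j < n.+1) (1 - f) ^+ j) k.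
Proof.
move=> f0 lekn; rewrite fps_sumE /fps_inv.
rewrite (big_ord_widen n.+1 (fun j => ((1 - f) ^+ j) k)) // big_mkcond /=.
apply: eq_bigr => i _; case: ltnP => // lt; rewrite fpsX_lt //.
by rewrite fpsBE f0 subrr.
Qed.

Lemma fps_mulV f : f 0%N = 1 -> f * fps_inv f = 1.
Proof.
move=> f0; apply/funext => n.
have -> : (f * fps_inv f) n = (f * \sum_(j < n.+1) (1 - f) ^+ j) n.
  by rewrite !fpsME; apply: eq_bigr => i _; rewrite (@fps_invE f n) ?leq_subr.
have -> : f * \sum_(j < n.+1) (1 - f) ^+ j = 1 - (1 - f) ^+ n.+1.
  by rewrite -[RHS]opprB subrX1 -mulNr opprB subKr.
by rewrite fpsBE (@fpsX_lt _ n.+1) ?subr0 // fpsBE f0 subrr.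
Qed.

End FpsRing.

(** * Words as power series *)

Section Words.
Variables (K : numFieldType) (q : K).
Hypothesis q_torsion : forall m, (0 < m)%N -> q ^+ m != 1.
Implicit Types (f g : fps K) (ks ls : seq nat) (d nc : bool).

(* A word w becomes the power series whose coefficients are the terms of the
   outermost sum of Z_q(w): the letter b acts as multiplication by
   t / (1 - t) = [fpsb], the letter a as [opa] : t^m |-> q^m / [m] t^m.  The
   junk value q^0 / [0] = 0 makes [opa] kill constants, which matches
   [ZqM_mono] being 0 on words that begin with a. *)
Definition hbar : K := 1 - q.
Definition xcoef (m : nat) : K := q ^+ m / ((1 - q ^+ m) / (1 - q)).
Definition opa f : fps K := fun m => xcoef m * f m.
Definition fpsb : fps K := fun m => (0 < m)%:R.

Lemma xcoef0 : xcoef 0 = 0.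
Proof. by rewrite /xcoef expr0 subrr mul0r invr0 mulr0. Qed.

Lemma fpsbME f m : (fpsb * f) m = \sum_(i < m) f i.
Proof.
rewrite mulrC fpsME big_ord_recr /= subnn /fpsb /= mulr0 addr0.
by apply: eq_bigr => i _; rewrite subn_gt0 ltn_ord mulr1.
Qed.

Lemma fpsbM0 f : (fpsb * f) 0%N = 0.
Proof. by rewrite fpsbME big_ord0. Qed.

Lemma opa0 f : opa f 0%N = 0.
Proof. by rewrite /opa xcoef0 mul0r. Qed.

Lemma opaD f g : opa (f + g) = opa f + opa g.
Proof. by apply/funext => m; rewrite /opa !fpsDE mulrDr. Qed.

Lemma opaC c f : opa (fpsC c * f) = fpsC c * opa f.
Proof. by apply/funext => m; rewrite /opa !fpsCM mulrCA. Qed.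

Lemma opa_sum I (r : seq I) (Q : pred I) (F : I -> fps K) :
  opa (\sum_(i <- r | Q i) F i) = \sum_(i <- r | Q i) opa (F i).
Proof.
apply: (big_morph opa opaD).
by apply/funext => m; rewrite /opa fps0E mulr0.
Qed.

(** For q nonzero put y_m = 1 / x_m. Then 1 + hbar y_m = q^-m is multiplicative in m, that is,
    y_{m+n} = y_m + y_n + hbar y_m y_n; multiply by x_m x_n x_{m+n}. At m = 0, where [xcoef] is 0,
    this breaks down, and therefore [opa_RB] asks for vanishing constant terms. *)
Lemma xcoefM m n : (0 < m)%N -> (0 < n)%N ->
  xcoef m * xcoef n = xcoef (m + n) * (xcoef m + xcoef n + hbar).
Proof.
move=> m0 n0; rewrite /xcoef /hbar exprD.
have hq : 1 - q != 0 by rewrite subr_eq0 eq_sym -(expr1 q) q_torsion.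
have hm : 1 - q ^+ m != 0 by rewrite subr_eq0 eq_sym q_torsion.
have hn : 1 - q ^+ n != 0 by rewrite subr_eq0 eq_sym q_torsion.
have hmn : 1 - q ^+ m * q ^+ n != 0.
  by rewrite -exprD subr_eq0 eq_sym q_torsion // addn_gt0 m0.
by field; rewrite hq hm hn hmn.
Qed.

(* The letter [a] is a Rota-Baxter operator of weight hbar; this is the
   analytic meaning of the product sh_hbar. *)
Lemma opa_RB f g : f 0%N = 0 -> g 0%N = 0 ->
  opa f * opa g = opa (f * opa g + opa f * g + fpsC hbar * (f * g)).
Proof.
move=> f0 g0; apply/funext => n.
rewrite /opa !fpsDE fpsCM !fpsME !mulr_sumr -!big_split /= mulr_sumr.
apply: eq_bigr => -[[|i] /= ltin] _; first by rewrite f0; ring.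
have [->|] := eqVneq (n - i.+1)%N 0%N; first by rewrite g0; ring.
rewrite -lt0n => ni0.
have /xcoefM : (0 < i.+1)%N by []. move=> /(_ _ ni0).
have -> : (i.+1 + (n - i.+1) = n)%N by lia.
move=> E.
transitivity (xcoef i.+1 * xcoef (n - i.+1) * (f i.+1 * g (n - i.+1)%N)); first by ring.
by rewrite E; ring.
Qed.

(* The action of the word indexed by the reverse of [ks]: last block first. *)
Definition Jop (ks : seq nat) f : fps K :=
  foldr (fun k u => iter k opa (fpsb * u)) f ks.

Definition linop (O : fps K -> fps K) :=
  (forall f g, O (f + g) = O f + O g) /\ (forall c f, O (fpsC c * f) = fpsC c * O f).

Lemma linop0 O : linop O -> O 0 = 0.
Proof. by case=> _ /(_ 0 0); rewrite rmorph0 !mul0r. Qed.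

Lemma linop_sum O (hO : linop O) I (r : seq I) (F : I -> fps K) :
  O (\sum_(i <- r) F i) = \sum_(i <- r) O (F i).
Proof. by apply: (big_morph O); [case: hO | apply: linop0]. Qed.

Lemma linopN O f : linop O -> O (- f) = - O f.
Proof. by case=> _ hC; rewrite -mulN1r -(rmorph1 (@fpsC K)) -rmorphN hC rmorphN rmorph1 mulN1r. Qed.

Lemma linopB O f g : linop O -> O (f - g) = O f - O g.
Proof. by move=> hO; case: (hO) => hD _; rewrite hD linopN. Qed.

Lemma linop_opa : linop opa. Proof. by split; [exact: opaD|exact: opaC]. Qed.
Lemma linop_mul u : linop (fun f => u * f).
Proof. by split=> *; rewrite ?mulrDr // mulrCA. Qed.
Lemma linop_comp O1 O2 : linop O1 -> linop O2 -> linop (O1 \o O2).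
Proof. by move=> [D1 C1] [D2 C2]; split=> * /=; rewrite ?D2 ?D1 ?C2 ?C1. Qed.
Lemma linop_iter O n : linop O -> linop (iter n O).
Proof.
move=> hO; elim: n => [|n IH]; first by split.
exact: (linop_comp hO IH).
Qed.
Lemma linop_Jop ks : linop (Jop ks).
Proof.
elim: ks => [|k ks IH]; first by split.
apply: (@linop_comp (fun f => iter k opa (fpsb * f)) (Jop ks)) => //.
exact: (linop_comp (linop_iter _ linop_opa) (linop_mul _)).
Qed.

Lemma Jop_cat ks ls f : Jop (ks ++ ls) f = Jop ks (Jop ls f).
Proof. by rewrite /Jop foldr_cat. Qed.

Definition heval (c : {poly rat}) : K := (map_poly (fun r : rat => ratr r : K) c).[1 - q].

Lemma hevalD : {morph heval : x y / x + y}.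
Proof. by move=> x y; rewrite /heval rmorphD hornerD. Qed.
Lemma hevalM : {morph heval : x y / x * y}.
Proof. by move=> x y; rewrite /heval rmorphM hornerM. Qed.
Lemma hevalX : heval 'X = hbar.
Proof. by rewrite /heval map_polyX hornerX. Qed.
Lemma hevalC (r : rat) : heval r%:P = ratr r.
Proof. by rewrite /heval map_polyC hornerC. Qed.
Lemma heval1 : heval 1 = 1. Proof. by rewrite -[1]/(1%:P) hevalC rmorph1. Qed.
Lemma hevalXn n : heval 'X^n = hbar ^+ n.
Proof. by elim: n => [|n IH]; rewrite ?heval1 // !exprS hevalM IH hevalX. Qed.

(** * Spans of words and divisibility by hbar *)

Definition lmono := ({poly rat} * seq nat)%type.

Definition evmono (x : lmono) : fps K := fpsC (heval x.1) * Jop x.2 1.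

Definition sp (Q : pred lmono) f :=
  exists2 p, all Q p & f = \sum_(x <- p) evmono x.

Section Span.
Variables (Q : pred lmono).

Lemma sp0 : sp Q 0.
Proof. by exists [::]; rewrite ?big_nil. Qed.
Lemma spD f g : sp Q f -> sp Q g -> sp Q (f + g).
Proof.
move=> [p hp ->] [r hr ->]; exists (p ++ r); first by rewrite all_cat hp.
by rewrite big_cat.
Qed.
Lemma sp_sum I (r : seq I) (F : I -> fps K) :
  (forall i, sp Q (F i)) -> sp Q (\sum_(i <- r) F i).
Proof. by move=> h; elim/big_ind: _ => //; [exact: sp0|exact: spD]. Qed.
Lemma sp_mono x : Q x -> sp Q (evmono x).
Proof. by move=> hx; exists [:: x]; rewrite /= ?hx ?big_seq1. Qed.

Lemma sp_op (Q' : pred lmono) O f : linop O ->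
  (forall x, Q x -> sp Q' (O (evmono x))) -> sp Q f -> sp Q' (O f).
Proof.
move=> hO h [p hp ->]; rewrite linop_sum //.
elim: p hp => [_|x p IH /andP[hx hp]]; first by rewrite big_nil; exists [::]; rewrite ?big_nil.
rewrite big_cons; have [p1 h1 ->] := h _ hx; have [p2 h2 ->] := IH hp.
by exists (p1 ++ p2); [rewrite all_cat h1|rewrite big_cat].
Qed.

Lemma sp_sub (Q' : pred lmono) f : (forall x, Q x -> Q' x) -> sp Q f -> sp Q' f.
Proof. by move=> h [p hp ->]; exists p => //; apply: sub_all hp. Qed.
End Span.

(* [kp d nc]: the monomial lies in C<A>; it is divisible by hbar (as an
   element of C<a,b>) if [d], and it is not a constant if [nc]. *)
Definition kp (d nc : bool) (x : lmono) : bool :=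
  (nc ==> (x.2 != [::])) &&
  ('X^(count_mem 0%N x.2 + (d && (0%N \notin x.2))) %| x.1).

Lemma evmonoC c x : evmono (c * x.1, x.2) = fpsC (heval c) * evmono x.
Proof. by rewrite /evmono hevalM rmorphM mulrA. Qed.

Lemma K_scale d nc c f : sp (kp d nc) f -> sp (kp d nc) (fpsC (heval c) * f).
Proof.
apply: sp_op => [|x /andP[h1 h2]]; first exact: linop_mul.
by rewrite -evmonoC; apply: sp_mono; rewrite /kp h1 /= dvdp_mull.
Qed.

Lemma K_scaleQ d nc (r : rat) f : sp (kp d nc) f -> sp (kp d nc) (fpsC (ratr r) * f).
Proof. by rewrite -hevalC; apply: K_scale. Qed.

Lemma K_opp d nc f : sp (kp d nc) f -> sp (kp d nc) (- f).
Proof.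
move=> /(K_scaleQ (-1)); rewrite rmorphN rmorph1 rmorphN rmorph1.
by rewrite mulN1r.
Qed.

Lemma K_weak (d nc d' nc' : bool) f : (d' -> d) -> (nc' -> nc) ->
  sp (kp d nc) f -> sp (kp d' nc') f.
Proof.
move=> hd hn; apply: sp_sub => x /andP[h1 h2]; apply/andP; split.
  by apply/implyP => /hn h; move: h1; rewrite h.
apply: dvdp_trans h2; rewrite dvdp_exp2l // leq_add2l.
by case: d' hd => // ->.
Qed.

Lemma K_hbar d nc f : sp (kp d nc) f -> sp (kp true nc) (fpsC hbar * f).
Proof.
apply: sp_op => [|x /andP[h1 h2]]; first exact: linop_mul.
rewrite -hevalX -evmonoC; apply: sp_mono; rewrite /kp h1 /=.
apply: (@dvdp_trans _ ('X * 'X^(count_mem 0%N x.2))).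
  by rewrite -exprS dvdp_exp2l // -addn1 leq_add2l leq_b1.
by rewrite dvdp_mul2l ?polyX_eq0 //; apply: dvdp_trans h2; rewrite dvdp_exp2l // leq_addr.
Qed.

Lemma evmono_opa c k ks : opa (evmono (c, k :: ks)) = evmono (c, k.+1 :: ks).
Proof. by rewrite /evmono opaC. Qed.
Lemma evmono_b c ks : fpsb * evmono (c, ks) = evmono (c, 0%N :: ks).
Proof. by rewrite /evmono mulrCA. Qed.

(** If the last letter is hbar b, it becomes g_1 and the hbar that it carried is set free; this
    factor keeps the result divisible by hbar. *)
Lemma K_opa d f : sp (kp d true) f -> sp (kp d true) (opa f).
Proof.
apply: sp_op => [|[c [|k ks]] /andP[//= _ h2]]; first exact: linop_opa.
rewrite evmono_opa; apply: sp_mono; apply: dvdp_trans h2; rewrite dvdp_exp2l //=.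
rewrite !inE add0n; case: k => [|k] //=.
by rewrite andbF addn0 add1n -addn1 leq_add2l leq_b1.
Qed.

Lemma K_opab d nc f : sp (kp d nc) f -> sp (kp d true) (opa (fpsb * f)).
Proof.
apply: (@sp_op _ _ (opa \o (fun u => fpsb * u))).
  exact: (linop_comp linop_opa (linop_mul _)).
move=> [c ks] /andP[_ h2]; rewrite /= evmono_b evmono_opa.
by apply: sp_mono; rewrite /kp /= add0n inE.
Qed.

Lemma K_hb d nc f : sp (kp d nc) f -> sp (kp true true) (fpsC hbar * (fpsb * f)).
Proof.
apply: (@sp_op _ _ ((fun u => fpsC hbar * u) \o (fun u => fpsb * u))).
  exact: (linop_comp (linop_mul _) (linop_mul _)).
move=> [c ks] /andP[_ /= h2]; rewrite /= evmono_b -hevalX -(evmonoC 'X (c, 0%N :: ks)) /=.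
apply: sp_mono; rewrite /kp /= addn0 add1n exprS dvdp_mul2l ?polyX_eq0 //.
by apply: dvdp_trans h2; rewrite dvdp_exp2l // leq_addr.
Qed.

(** The word over the alphabet A: every block 0 stands for the letter hbar b, hence the power of
    ['X]. These words span C<A>. *)
Definition wJ ks : fps K := evmono ('X^(count_mem 0%N ks), ks).

Lemma wJ0 ks : wJ (0%N :: ks) = fpsC hbar * (fpsb * wJ ks).
Proof. by rewrite /wJ /= add1n exprS (evmonoC 'X (_, _ :: _)) hevalX evmono_b. Qed.
Lemma wJ1 ks : wJ (1%N :: ks) = opa (fpsb * wJ ks).
Proof. by rewrite /wJ /= add0n evmono_b evmono_opa. Qed.
Lemma wJSS k ks : wJ (k.+2 :: ks) = opa (wJ (k.+1 :: ks)).
Proof. by rewrite /wJ /= add0n evmono_opa. Qed.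
Lemma wJnil : wJ [::] = 1.
Proof. by rewrite /wJ /evmono heval1 rmorph1 mul1r. Qed.

Lemma wJ_sp ks : sp (kp (0%N \in ks) (ks != [::])) (wJ ks).
Proof.
apply: sp_mono; rewrite /kp /= implybb /=.
by rewrite andbN addn0.
Qed.

Lemma wJ_const0 k ks : wJ (k :: ks) 0%N = 0.
Proof.
case: k => [|[|k]]; first by rewrite wJ0 fpsCM fpsbM0 mulr0.
  by rewrite wJ1 opa0.
by rewrite wJSS opa0.
Qed.

Let msr ks := (sumn ks + size ks)%N.

(** Induction on the total number of letters a and b: a final hbar b is pulled out of the product,
    and two final letters a are resolved by [opa_RB]. Thus C<A> is closed under sh_hbar. *)
Lemma wJM ks ls :
  sp (kp ((0%N \in ks) || (0%N \in ls)) ((ks != [::]) || (ls != [::]))) (wJ ks * wJ ls).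
Proof.
have [n] := ubnP (msr ks + msr ls).
elim: n ks ls => // n IH [|k ks] ls.
  by rewrite wJnil mul1r => _; apply: wJ_sp.
case: ls => [|l ls].
  by rewrite wJnil mulr1 orbF => _; apply: wJ_sp.
rewrite /msr /= !addnS !ltnS => hn.
pose d := (0%N \in k :: ks) || (0%N \in l :: ls).
case: k @d hn => [|k] d hn.
  have := IH ks (l :: ls); rewrite /msr /= => /(_ ltac:(lia)) /K_hb.
  by rewrite wJ0 !mulrA => h; apply: K_weak h.
case: l @d hn => [|l] d hn.
  have := IH (k.+1 :: ks) ls; rewrite /msr /= => /(_ ltac:(lia)) /K_hb.
  rewrite wJ0 [in X in _ -> X]mulrCA [X in _ -> sp _ (_ * X)]mulrCA.
  by apply: K_weak.
have dE : (0%N \in k.+1 :: ks) || (0%N \in l.+1 :: ls) = (0%N \in ks) || (0%N \in ls) by [].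
(* [u] is the word without its last a. A bare b lacks the factor hbar, so for [k = 0] it is not
   [wJ (0 :: ks)]. *)
pose u k ks := if k is 0%N then fpsb * wJ ks else wJ (k :: ks).
have uE k0 ks0 : wJ (k0.+1 :: ks0) = opa (u k0 ks0).
  by case: k0 => [|k0] /=; rewrite ?wJ1 ?wJSS.
have u0 k0 ks0 : u k0 ks0 0%N = 0.
  by case: k0 => [|k0] /=; rewrite ?fpsbM0 ?wJ_const0.
rewrite /= {1}(uE k) {1}(uE l) opa_RB // -!uE !opaD.
do ![apply: spD].
- case: k {d} dE hn => [|k] dE hn /=.
    have := IH ks (l.+1 :: ls); rewrite /msr /= => /(_ ltac:(lia)) /K_opab.
    by rewrite mulrA dE; apply: K_weak.
  by have := IH (k.+1 :: ks) (l.+1 :: ls); rewrite /msr /= => /(_ ltac:(lia)) /K_opa.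
- case: l {d} dE hn => [|l] dE hn /=.
    have := IH (k.+1 :: ks) ls; rewrite /msr /= => /(_ ltac:(lia)) /K_opab.
    by rewrite mulrCA dE; apply: K_weak.
  by have := IH (k.+1 :: ks) (l.+1 :: ls); rewrite /msr /= => /(_ ltac:(lia)) /K_opa.
case: k {d} dE hn => [|k] dE hn; case: l dE hn => [|l] dE hn /=.
(* Two bare letters b meet: the weight hbar of the Rota-Baxter identity completes one of them to
   hbar b, and the outer P turns the other into ba. *)
- have := IH ks ls; rewrite /msr /= => /(_ ltac:(lia)) /K_hb /K_opab.
  have -> : fpsC hbar * (fpsb * wJ ks * (fpsb * wJ ls)) =
            fpsb * (fpsC hbar * (fpsb * (wJ ks * wJ ls))) by ring.
  by apply: K_weak.
- have := IH ks (l.+1 :: ls); rewrite /msr /= => /(_ ltac:(lia)) /K_opab /K_hbar.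
  by rewrite -mulrA opaC; apply: K_weak.
- have := IH (k.+1 :: ks) ls; rewrite /msr /= => /(_ ltac:(lia)) /K_opab /K_hbar.
  by rewrite mulrCA opaC; apply: K_weak.
- have := IH (k.+1 :: ks) (l.+1 :: ls); rewrite /msr /= => /(_ ltac:(lia)) /K_opa /K_hbar.
  by rewrite opaC; apply: K_weak.
Qed.

Lemma kp_wJ d nc x : kp d nc x ->
  exists2 c, evmono x = fpsC (heval c) * wJ x.2 & (d && (0%N \notin x.2) ==> ('X %| c)).
Proof.
case: x => c ks /andP[_ /= hc].
have /divpK <- := hc.
set c1 := c %/ _; exists (c1 * 'X^(d && (0%N \notin ks))).
  rewrite /wJ -evmonoC /= exprD; congr (evmono (_, _)); ring.
by case: (d && _) => //=; rewrite expr1 dvdp_mull.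
Qed.

(** Divisibility by hbar has two sources: a letter hbar b in one of the words, which [wJM]
    preserves, or a spare hbar in a coefficient. Hence the multiples of hbar form an ideal of the
    shuffle algebra C<A>. *)
Lemma K_mul d1 n1 d2 n2 f g : sp (kp d1 n1) f -> sp (kp d2 n2) g ->
  sp (kp (d1 || d2) (n1 || n2)) (f * g).
Proof.
move=> hf hg; move: hf; apply: (@sp_op _ _ (fun f => f * g)).
  by split=> *; rewrite ?mulrDl ?mulrA.
move=> x hx; move: hg; apply: sp_op => [|y hy]; first exact: linop_mul.
have [c1 -> h1] := kp_wJ hx; have [c2 -> h2] := kp_wJ hy.
have -> : fpsC (heval c1) * wJ x.2 * (fpsC (heval c2) * wJ y.2) =
   fpsC (heval (c1 * c2)) * (wJ x.2 * wJ y.2) by rewrite hevalM rmorphM; ring.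
have /andP[hnx _] := hx; have /andP[hny _] := hy.
have hW := wJM x.2 y.2.
have hn : n1 || n2 -> (x.2 != [::]) || (y.2 != [::]).
  by case: n1 hnx {hx} => /= [->|_] //; case: n2 hny {hy} => //= ->; rewrite orbT.
have [dd|] := boolP ((0%N \in x.2) || (0%N \in y.2)).
  by apply: K_scale; apply: K_weak hW.
rewrite negb_or => /andP[nx ny]; move: h1 h2; rewrite nx ny !andbT => h1 h2.
have [dd|nd] := boolP (d1 || d2); last by apply: K_scale; apply: K_weak hW => //; rewrite (negbTE nd).
have : 'X %| c1 * c2.
  by case: d1 h1 dd {hx} => /= [?|_ dd]; [rewrite dvdp_mulr|rewrite dvdp_mull //; move: h2; rewrite dd].
move=> /divpK <-; rewrite hevalM hevalX rmorphM -mulrA.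
by apply: K_scale; apply: K_weak (K_hbar hW).
Qed.

Lemma K_one : sp (kp false false) 1.
Proof. by rewrite -wJnil; have := wJ_sp [::]. Qed.

End Words.

(** * The generating series in X *)

Lemma fps_ode_uniq (A : comNzRingType) (U Y Z : fps A) :
  (forall n, injective (fun x : A => x *+ n.+1)) ->
  fps_deriv Y = U * Y -> fps_deriv Z = U * Z -> Y 0%N = Z 0%N -> Y = Z.
Proof.
move=> inj hY hZ h0; apply/funext => n.
elim/ltn_ind: n => -[//|n] IH; apply: (inj n).
rewrite -[_ *+ _]/(fps_deriv Y n) -[RHS]/(fps_deriv Z n) hY hZ !fpsME.
by apply: eq_bigr => i _; rewrite IH // ltnS leq_subr.
Qed.

Lemma mulrSn_inj (K : numFieldType) n : injective (fun x : K => x *+ n.+1).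
Proof.
by move=> x y /eqP; rewrite -subr_eq0 -mulrnBl mulrn_eq0 /= subr_eq0 => /eqP.
Qed.

Lemma fps_mulrSn_inj (K : numFieldType) n : injective (fun x : fps K => x *+ n.+1).
Proof.
move=> x y /= h; apply/funext => m; apply: (@mulrSn_inj K n) => /=.
by move: (congr1 (fun u : fps K => u m) h); rewrite !fpsMnE.
Qed.

Section Exp.
Variable K : numFieldType.
Implicit Types u v : fps K.

Definition fexp u : fps (fps K) := fun n => fpsC (n`!%:R^-1) * u ^+ n.

Lemma fexp0 u : fexp u 0%N = 1.
Proof. by rewrite /fexp fact0 invr1 rmorph1 mul1r expr0. Qed.

Lemma fexp_deriv u : fps_deriv (fexp u) = fpsC u * fexp u.
Proof.
have E n : (n.+1`!%:R^-1 : K) *+ n.+1 = n`!%:R^-1.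
  by rewrite factS natrM invfM -mulrnAl -mulr_natr mulVf ?pnatr_eq0 // mul1r.
apply/funext => n; rewrite fpsCM /fps_deriv /fexp exprS.
by rewrite -mulrnAl -raddfMn E mulrCA.
Qed.

Lemma fexpVK u : fexp u * fexp (- u) = 1.
Proof.
apply: (@fps_ode_uniq _ 0).
- exact: fps_mulrSn_inj.
- by rewrite fps_derivM !fexp_deriv rmorphN /=; ring.
- by rewrite fps_deriv1 mul0r.
- by rewrite fpsME big_ord1 !fexp0 mulr1.
Qed.
End Exp.

Section XSeries.
Variables (K : numFieldType) (q : K).
Hypothesis q_torsion : forall m, (0 < m)%N -> q ^+ m != 1.
Implicit Types (f : fps K) (F G : fps (fps K)) (ks ls : seq nat) (d nc : bool).

Local Notation P := (opa q).
Local Notation b := (fpsb K).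
Local Notation h := (fpsC (hbar q)).

Definition opL : fps K := P b.
Definition opaX F : fps (fps K) := fun n => P (F n).
(* [A1] is the image of 1 / (1 - g_1 X), the outer variable being X. *)
Definition A1 : fps (fps K) := fun n => Jop q (nseq n 1%N) 1.

Lemma opaXD F G : opaX (F + G) = opaX F + opaX G.
Proof. by apply/funext => n; rewrite /opaX !fpsDE opaD. Qed.

Lemma opaMn f n : P (f *+ n) = P f *+ n.
Proof.
elim: n => [|n IH]; first exact: linop0 (linop_opa q).
by rewrite !mulrS opaD IH.
Qed.

Lemma opaX_fpsX F : opaX (@fpsX _ * F) = @fpsX _ * opaX F.
Proof.
apply/funext => -[|n]; rewrite /opaX ?fpsXM0 ?fpsXMS //.
by apply: linop0; apply: linop_opa.
Qed.

Lemma opaX_RB F G : (forall n, F n 0%N = 0) -> (forall n, G n 0%N = 0) ->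
  opaX F * opaX G = opaX (F * opaX G + opaX F * G + fpsC h * (F * G)).
Proof.
move=> F0 G0; apply/funext => n; rewrite {3}/opaX !fpsDE fpsCM !fpsME.
rewrite mulr_sumr -!big_split /= opa_sum; apply: eq_bigr => i _.
by rewrite /opaX opa_RB.
Qed.

Lemma A1_rec : A1 = 1 + @fpsX _ * opaX (fpsC b * A1).
Proof.
apply/funext => -[|n]; rewrite fpsDE ?fpsXM0 ?fpsXMS ?addr0 //.
by rewrite fps1E add0r /opaX fpsCM.
Qed.

(** The Rota-Baxter identity gives A1 P(F) = P(F D1) + X P(b A1 P(F)), so A1 P(F) is the series of
    P(f) followed by 1 / (1 - g_1 X) as soon as F D1 = f. This forces [c1]; [D2] is the inverse of
    [c2], to be compared with [D1]. *)
Definition D1 : fps (fps K) := A1 * (1 + @fpsX _ * fpsC (h * b)).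
Definition D2 : fps (fps K) := fexp (opL + h * b).
Definition c1 := fps_inv D1.
Definition c2 := fexp (- (opL + h * b)).

Lemma D1_0 : D1 0%N = 1.
Proof. by rewrite /D1 fpsME big_ord1 /= fpsDE fpsXM0 addr0 mulr1. Qed.

Lemma fps_mul00 (f f' : fps K) : f 0%N = 0 -> (f * f') 0%N = 0.
Proof. by move=> h0; rewrite fpsME big_ord1 h0 mul0r. Qed.

(* Both sides solve F = P f + X P(b F): expand the product on the right with
   the Rota-Baxter identity. *)
Lemma A1_shuffle f : f 0%N = 0 -> forall n,
  Jop q (nseq n 1%N) (P f) = (A1 * opaX (fpsC f * c1)) n.
Proof.
move=> f0; set F := fpsC f * c1; set G := A1 * opaX F.
have F0 n : F n 0%N = 0 by rewrite /F fpsCM fps_mul00.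
have bA0 n : (fpsC b * A1) n 0%N = 0 by rewrite fpsCM fpsbM0.
have FD : F * D1 = fpsC f by rewrite /F -mulrA [c1 * _]mulrC fps_mulV ?D1_0 ?mulr1.
have GE : G = opaX (fpsC f) + @fpsX _ * opaX (fpsC b * G).
  rewrite /G {1}A1_rec mulrDl mul1r -mulrA opaX_RB // !opaXD.
  rewrite mulrA -FD /D1 !mulrDr -!opaX_fpsX -!opaXD; congr opaX.
  transitivity (F * (1 + @fpsX _ * opaX (fpsC b * A1)) + @fpsX _ * (fpsC b * A1 * opaX F)
     + @fpsX _ * (fpsC h * (fpsC b * A1 * F))); first by ring.
  by rewrite -A1_rec rmorphM; ring.
elim=> [|n IH].
  by rewrite GE fpsDE fpsXM0 addr0.
rewrite GE fpsDE fpsXMS {1}/opaX {1}/fpsC /= (linop0 (linop_opa q)) add0r.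
by rewrite /opaX fpsCM -IH.
Qed.

(* [T_S] is the differential equation T' = L T - T (L - P b) in X satisfied by
   concatenation on the right with exp_sh(g_1 X). *)
Section Tseries.
Variable T : fps K -> fps (fps K).
Hypothesis T_lin : forall n, linop (fun f => T f n).
Hypothesis T_0 : forall f, T f 0%N = f.
Hypothesis T_S : forall n f,
  T f n.+1 *+ n.+1 = opL * T f n - T (opL * f - P (b * f)) n.

Lemma T_one n : T 1 n = fexp opL n.
Proof.
have -> : T 1 = fexp opL; last by [].
apply: (@fps_ode_uniq _ (fpsC opL)).
- exact: fps_mulrSn_inj.
- apply/funext => m; rewrite fpsCM /fps_deriv T_S !mulr1 /opL subrr.
  by rewrite (linop0 (T_lin m)) subr0.
- exact: fexp_deriv.
- by rewrite T_0 fexp0.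
Qed.

(** By the Rota-Baxter identity L P(f) - P(b P(f)) = P((L + hb) f): on the image of P, the
    correction term of [T_S] is multiplication of f by L + hb. The factor exp(- X (L + hb)) absorbs
    it. *)
Lemma T_shuffle f : f 0%N = 0 -> forall n,
  T (P f) n = (fexp opL * opaX (fpsC f * c2)) n.
Proof.
move=> f0 n; elim: n f f0 => [|n IH] f f0.
  by rewrite T_0 fpsME big_ord1 fexp0 mul1r /opaX fpsCM /c2 fexp0 mulr1.
apply: (@fps_mulrSn_inj K n); rewrite /= T_S.
have -> : opL * P f - P (b * P f) = P ((opL + h * b) * f).
  rewrite /opL opa_RB // -/opL !opaD mulrDl opaD addrAC; congr (_ + P _); last by rewrite mulrA.
  by rewrite addrC addKr.
have b0 : (h * b) 0%N = 0 by rewrite fpsCM mulr0.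
rewrite !IH //; last first.
  by rewrite mulrC fps_mul00.
rewrite -[RHS]/(fps_deriv (fexp opL * opaX (fpsC f * c2)) n).
have -> : fps_deriv (fexp opL * opaX (fpsC f * c2)) =
    fpsC opL * (fexp opL * opaX (fpsC f * c2)) -
    fexp opL * opaX (fpsC ((opL + h * b) * f) * c2).
  rewrite fps_derivM fexp_deriv -mulrA -mulrN; congr (_ + _ * _).
  apply/funext => m; rewrite fpsNE /opaX /fps_deriv !fpsCM -(linopN _ (linop_opa q)).
  rewrite -opaMn; congr P; rewrite -mulrnAr.
  have -> : c2 m.+1 *+ m.+1 = fps_deriv c2 m by [].
  by rewrite /c2 fexp_deriv fpsCM; ring.
by rewrite fpsBE fpsCM.
Qed.
End Tseries.

Definition spX d F := forall n, sp q (kp d false) (F n).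

Lemma spXD d F G : spX d F -> spX d G -> spX d (F + G).
Proof. by move=> hF hG n; rewrite fpsDE; apply: spD. Qed.
Lemma spXN d F : spX d F -> spX d (- F).
Proof. by move=> hF n; rewrite fpsNE; apply: K_opp. Qed.
Lemma spXM d d' F G : spX d F -> spX d' G -> spX (d || d') (F * G).
Proof. by move=> hF hG n; rewrite fpsME; apply: sp_sum => i; exact: (K_mul q_torsion (hF _) (hG _)). Qed.
Lemma spX1 : spX false 1.
Proof. by move=> n; rewrite fps1E; case: eqP => _; [exact: K_one|exact: sp0]. Qed.
Lemma spX_fpsX d F : spX d F -> spX d (@fpsX _ * F).
Proof. by move=> hF -[|n]; rewrite ?fpsXM0 ?fpsXMS //; exact: sp0. Qed.
Lemma spXC d f : sp q (kp d false) f -> spX d (fpsC f).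
Proof. by move=> hf n; rewrite /fpsC; case: eqP => // _; exact: sp0. Qed.

Lemma spX_inv F : spX false F -> spX false (fps_inv F).
Proof.
move=> hF n; rewrite /fps_inv; apply: sp_sum => i.
have : spX false ((1 - F) ^+ i); last exact.
elim: {i}(i : nat) => [|i IH]; first exact: spX1.
by rewrite exprS; apply: (@spXM false false) => //; apply: spXD spX1 _; apply: spXN.
Qed.

Lemma hb_sp : sp q (kp true false) (h * b).
Proof.
have := K_hb (K_one q); rewrite mulr1; exact: K_weak.
Qed.

Lemma opL_sp : sp q (kp false true) opL.
Proof. by have := K_opab (K_one q); rewrite mulr1. Qed.

Lemma A1_sp : spX false A1.
Proof.
elim=> [|n IH]; first exact: K_one.
by have := K_opab IH; apply: K_weak.
Qed.

(** With weight 0 in place of hbar, the product of g_1 and g_1^n would be exactly (n+1) g_1^(n+1).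
    The weight term inserts a letter hbar b, and the induction carries this error along. *)
Lemma A1_L n : sp q (kp true false) (opL * A1 n - A1 n.+1 *+ n.+1).
Proof.
elim: n => [|n IH].
  by rewrite /A1 /= mulr1 /opL mulr1 subrr; exact: sp0.
have -> : A1 n.+2 = P (b * A1 n.+1) by [].
have -> : A1 n.+1 = P (b * A1 n) by [].
rewrite {1}/opL opa_RB ?fpsbM0 // -/opL.
have -> : P (b * P (b * A1 n) + opL * (b * A1 n) + h * (b * (b * A1 n))) -
    P (b * P (b * A1 n)) *+ n.+2 =
  P (b * (opL * A1 n - A1 n.+1 *+ n.+1)) + P (b * (h * (b * A1 n))).
  rewrite [A1 n.+1]/(P (b * A1 n)) !opaD mulrBr (linopB _ _ (linop_opa q)).
  rewrite mulrnAr opaMn [opL * (b * _)]mulrCA [h * (b * _)]mulrCA mulrS.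
  by rewrite opprD [in RHS]addrC; ring.
apply: spD; first by have := K_opab IH; apply: K_weak.
by have := K_opab (K_hb (A1_sp n)); apply: K_weak.
Qed.

Lemma K_mulrSnV d nc f n : sp q (kp d nc) (f *+ n.+1) -> sp q (kp d nc) f.
Proof.
move=> /(K_scaleQ (n.+1%:R^-1)); rewrite fmorphV rmorph_nat.
rewrite mulrnAr -mulrnAl -raddfMn /= -[_ *+ n.+1]mulr_natr mulVf ?pnatr_eq0 //.
by rewrite rmorph1 mul1r.
Qed.

Lemma fexp_sp u : sp q (kp false false) u -> spX false (fexp u).
Proof.
move=> hu n; rewrite /fexp.
have -> : n`!%:R^-1 = ratr (n`!%:R^-1 : rat) :> K by rewrite fmorphV rmorph_nat.
apply: K_scaleQ; elim: n => [|n IH]; first exact: K_one.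
by rewrite exprS; apply: (K_mul q_torsion hu IH).
Qed.

Lemma fexpD_sp u v : sp q (kp false false) u -> sp q (kp true false) v ->
  spX true (fexp (u + v) - fexp u).
Proof.
move=> hu hv n; rewrite fpsBE /fexp -mulrBr.
have -> : n`!%:R^-1 = ratr (n`!%:R^-1 : rat) :> K by rewrite fmorphV rmorph_nat.
have huv : sp q (kp false false) (u + v) by apply: spD => //; apply: K_weak hv.
have hX m : sp q (kp false false) ((u + v) ^+ m).
  elim: m => [|m IH]; first exact: K_one.
  by rewrite exprS; apply: (K_mul q_torsion huv IH).
apply: K_scaleQ; elim: n => [|n IH]; first by rewrite subrr; exact: sp0.
rewrite !exprS.
have -> : (u + v) * (u + v) ^+ n - u * u ^+ n =
  v * (u + v) ^+ n + u * ((u + v) ^+ n - u ^+ n) by ring.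
by apply: spD; [exact: (K_mul q_torsion hv (hX n))|exact: (K_mul q_torsion hu IH)].
Qed.

Lemma opL_sp0 : sp q (kp false false) opL.
Proof. by apply: K_weak opL_sp. Qed.

Lemma A1_fexp : spX true (A1 - fexp opL).
Proof.
elim=> [|n IH]; first by rewrite fpsBE fexp0 /A1 /= subrr; exact: sp0.
apply: (@K_mulrSnV _ _ _ n).
have -> : (A1 - fexp opL) n.+1 *+ n.+1 =
    opL * (A1 - fexp opL) n - (opL * A1 n - A1 n.+1 *+ n.+1).
  rewrite !fpsBE mulrnBl -[fexp opL n.+1 *+ _]/(fps_deriv (fexp opL) n).
  by rewrite fexp_deriv fpsCM; ring.
apply: spD; first exact: (K_mul q_torsion opL_sp0 IH).
by apply: K_opp; apply: A1_L.
Qed.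

Lemma D12_sp : spX true (D2 - D1).
Proof.
have -> : D2 - D1 = (D2 - fexp opL) - (A1 - fexp opL) - A1 * (@fpsX _ * fpsC (h * b)).
  by rewrite /D1; ring.
apply: spXD; first apply: spXD.
- exact: fexpD_sp opL_sp0 hb_sp.
- by apply: spXN; exact: A1_fexp.
apply: spXN; apply: (@spXM false true _ _ A1_sp); apply: spX_fpsX; apply: spXC.
exact: hb_sp.
Qed.

Lemma c12_sp : spX true (c1 - c2).
Proof.
have D1c : D1 * c1 = 1 by rewrite fps_mulV ?D1_0.
have D2c : D2 * c2 = 1 by rewrite /D2 fexpVK.
have -> : c1 - c2 = c1 * c2 * (D2 - D1).
  transitivity (c1 * (D2 * c2) - c2 * (D1 * c1)); first by rewrite D1c D2c !mulr1.
  by ring.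
have hLhb : sp q (kp false false) (opL + h * b).
  by apply: spD opL_sp0 _; apply: K_weak hb_sp.
apply: (@spXM false true _ _ _ D12_sp); apply: (@spXM false false).
  apply: spX_inv; apply: (@spXM false false _ _ A1_sp); apply: spXD spX1 _.
  by apply: spX_fpsX; apply: spXC; apply: K_weak hb_sp.
by apply: fexp_sp; apply: K_opp.
Qed.

End XSeries.

(** * Shuffles of words in b and ba *)

Lemma rsh_nil_r u : rsh u [::] = [:: (1, u)].
Proof. by case: u. Qed.

Lemma rsh_b_l u v : rsh (Lb :: u) v = happ_letter Lb (rsh u v).
Proof. by case: v => [|y v] //=; rewrite rsh_nil_r. Qed.

Lemma rsh_b_r u v : rsh u (Lb :: v) = happ_letter Lb (rsh u v).
Proof.
elim: u => [//|[] u IH] //.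
by rewrite !rsh_b_l IH.
Qed.

(* The reversed word of b a^{k_1} ... b a^{k_r}, indexed by [k_r; ...; k_1]. *)
Definition rw (ks : seq nat) : word :=
  foldr (fun k w => nseq k La ++ Lb :: w) [::] ks.

Lemma rsh_ba_ba us vs : rsh (rw (1%N :: us)) (rw (1%N :: vs)) =
  happ_letter La (happ_letter Lb (rsh (rw (1%N :: us)) (rw vs)) ++
    happ_letter Lb (rsh (rw us) (rw (1%N :: vs))) ++
    hscale 'X (happ_letter Lb (happ_letter Lb (rsh (rw us) (rw vs))))).
Proof.
transitivity (happ_letter La (rsh (rw (1%N :: us)) (Lb :: rw vs) ++
   rsh (Lb :: rw us) (rw (1%N :: vs)) ++ hscale 'X (rsh (Lb :: rw us) (Lb :: rw vs)))).
  by [].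
by rewrite rsh_b_r !rsh_b_l rsh_b_r.
Qed.

Definition le1 (k : nat) := (k <= 1)%N.

Lemma rw_cons k ks : rw (k :: ks) = nseq k La ++ Lb :: rw ks.
Proof. by []. Qed.

(* The restriction of rsh to (reversed) words in the letters b and ba, which
   are encoded by lists over {0, 1}. *)
Fixpoint lsh (us : seq nat) : seq nat -> seq lmono :=
  match us with
  | [::] => fun vs => [:: (1, vs)]
  | x :: us' =>
    fix lshu (vs : seq nat) : seq lmono :=
      match vs with
      | [::] => [:: (1, x :: us')]
      | y :: vs' =>
        if x == 0%N then [seq (z.1, 0%N :: z.2) | z <- lsh us' vs] else
        if y == 0%N then [seq (z.1, 0%N :: z.2) | z <- lshu vs'] else
        [seq (z.1, 1%N :: z.2) | z <- lshu vs' ++ lsh us' vs] ++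
        [seq ('X * z.1, [:: 1%N, 0%N & z.2]) | z <- lsh us' vs']
      end
  end.

Lemma lsh_nil_r us : lsh us [::] = [:: (1, us)].
Proof. by case: us. Qed.

Lemma lsh0 us vs : lsh (0%N :: us) vs = [seq (z.1, 0%N :: z.2) | z <- lsh us vs].
Proof. by case: vs => [|y vs] //=; rewrite lsh_nil_r. Qed.

Lemma lsh10 us vs :
  lsh (1%N :: us) (0%N :: vs) = [seq (z.1, 0%N :: z.2) | z <- lsh (1%N :: us) vs].
Proof. by []. Qed.

Lemma lsh11 us vs : lsh (1%N :: us) (1%N :: vs) =
  [seq (z.1, 1%N :: z.2) | z <- lsh (1%N :: us) vs ++ lsh us (1%N :: vs)] ++
        [seq ('X * z.1, [:: 1%N, 0%N & z.2]) | z <- lsh us vs].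
Proof. by []. Qed.

Lemma lsh_ind (Q : seq nat -> seq nat -> Prop) :
  (forall vs, all le1 vs -> Q [::] vs) ->
  (forall us, all le1 us -> Q us [::]) ->
  (forall us vs, all le1 us -> all le1 vs -> Q us vs -> Q (0%N :: us) vs) ->
  (forall us vs, all le1 us -> all le1 vs -> Q (1%N :: us) vs -> Q (1%N :: us) (0%N :: vs)) ->
  (forall us vs, all le1 us -> all le1 vs -> Q (1%N :: us) vs -> Q us (1%N :: vs) ->
    Q us vs -> Q (1%N :: us) (1%N :: vs)) ->
  forall us vs, all le1 us -> all le1 vs -> Q us vs.
Proof.
move=> h1 h2 h3 h4 h5; elim=> [|[|[|//]] us IHu] vs /=; [by auto|by auto|].
move=> hu; elim: vs => [|[|[|//]] vs IHv] /= hv; [exact: h2|by auto|].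
by apply: h5 => //; [exact: IHv|exact: IHu|exact: IHu].
Qed.

Lemma rsh_lsh us vs : all le1 us -> all le1 vs ->
  rsh (rw us) (rw vs) = [seq (z.1, rw z.2) | z <- lsh us vs].
Proof.
move: us vs; apply: lsh_ind => [vs|us|us vs|us vs|us vs] // hu.
- by rewrite rsh_nil_r lsh_nil_r.
- by move=> hv IH; rewrite lsh0 rsh_b_l IH /happ_letter -!map_comp.
- by move=> hv IH; rewrite rsh_b_r IH /= /happ_letter -!map_comp.
move=> hv IH1 IH2 IH3.
rewrite rsh_ba_ba IH1 IH2 IH3 lsh11 /happ_letter /hscale !map_cat -!map_comp.
by rewrite -catA.
Qed.

(** The weight term has one b more than the other two, but it counts as the two letters hbar b and
    ba; so the number of letters is additive. *)
Lemma lsh_size us vs : all le1 us -> all le1 vs ->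
  all (fun z => size z.2 == (size us + size vs)%N) (lsh us vs).
Proof.
move: us vs; apply: lsh_ind => [vs|us|us vs|us vs|us vs] hu.
- by rewrite /= eqxx.
- by rewrite lsh_nil_r /= addn0 eqxx.
- move=> hv IH; rewrite lsh0 all_map; apply: sub_all IH => z /=.
  by rewrite addSn eqSS.
- move=> hv IH; rewrite all_map; apply: sub_all IH => z /=.
  by rewrite !addSn addnS eqSS.
move=> hv IH1 IH2 IH3; rewrite lsh11 map_cat !all_cat !all_map -andbA.
apply/and3P; split; [apply: sub_all IH1|apply: sub_all IH2|apply: sub_all IH3] => z /=.
- by rewrite !addSn addnS eqSS.
- by rewrite !addSn addnS eqSS.
- by rewrite !addSn addnS !eqSS.
Qed.

Lemma lsh_le1 us vs : all le1 us -> all le1 vs -> all (fun z => all le1 z.2) (lsh us vs).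
Proof.
move: us vs; apply: lsh_ind => [vs|us|us vs|us vs|us vs] hu.
- by rewrite /= hu.
- by rewrite lsh_nil_r /= hu.
- by move=> hv IH; rewrite lsh0 all_map; apply: sub_all IH.
- by move=> hv IH; rewrite all_map; apply: sub_all IH.
move=> hv IH1 IH2 IH3; rewrite lsh11 map_cat !all_cat !all_map -andbA.
by apply/and3P; split; [apply: sub_all IH1|apply: sub_all IH2|apply: sub_all IH3].
Qed.

(** The default 1 lets the empty word pass. The condition keeps words convergent when they are
    appended to elements of n. *)
Definition last1 (us : seq nat) := head 1%N us == 1%N.

Lemma lsh_last1 us vs : all le1 us -> all le1 vs -> last1 us -> last1 vs ->
  all (fun z => last1 z.2) (lsh us vs).
Proof.
case: us => [|[|[|//]] us] //; first by move=> ? _ _ /= ->.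
case: vs => [|[|[|//]] vs] //.
by move=> *; apply/allP => z; rewrite lsh11 mem_cat => /orP[] /mapP[y _ ->].
Qed.

(** Every new bare b comes from the weight term and brings its own ['X], so the shuffle of words
    over {hbar b, ba} stays over this alphabet. *)
Lemma lsh_count us vs : all le1 us -> all le1 vs ->
  all (fun z => 'X^(count_mem 0%N z.2) %| 'X^(count_mem 0%N us + count_mem 0%N vs) * z.1)
    (lsh us vs).
Proof.
move: us vs; apply: lsh_ind => [vs|us|us vs|us vs|us vs] hu.
- by rewrite /= mulr1 dvdpp.
- by rewrite lsh_nil_r /= addn0 mulr1 dvdpp.
- move=> hv IH; rewrite lsh0 all_map; apply: sub_all IH => z /=.
  by rewrite !add1n addSn !exprS -mulrA dvdp_mul2l ?polyX_eq0.
- move=> hv IH; rewrite all_map; apply: sub_all IH => z /=.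
  by rewrite !add0n !add1n addnS !exprS -mulrA dvdp_mul2l ?polyX_eq0.
move=> hv IH1 IH2 IH3; rewrite lsh11 map_cat !all_cat !all_map -andbA.
apply/and3P; split; [apply: sub_all IH1|apply: sub_all IH2|apply: sub_all IH3] => z /=.
- by rewrite !add0n.
- by rewrite !add0n.
- by rewrite !add0n !add1n !exprS [_ * ('X * _)]mulrCA dvdp_mul2l ?polyX_eq0.
Qed.

(* The sum of the coefficients at hbar = 0. *)
Definition leps (p : seq lmono) : rat := \sum_(z <- p) z.1`_0.

Lemma leps_cat p r : leps (p ++ r) = leps p + leps r.
Proof. by rewrite /leps big_cat. Qed.
Lemma leps_map (F : seq nat -> seq nat) p : leps [seq (z.1, F z.2) | z <- p] = leps p.
Proof. by rewrite /leps big_map. Qed.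

(** At hbar = 0 the weight term drops out and the recursion becomes Pascal's rule. *)
Lemma lsh_leps i j : leps (lsh (nseq i 1%N) (nseq j 1%N)) = 'C(i + j, i)%:R.
Proof.
elim: i j => [|i IHi] j; first by rewrite /leps /= big_seq1 bin0 coef1.
elim: j => [|j IHj]; first by rewrite /leps lsh_nil_r /= big_seq1 addn0 binn coef1.
have -> : lsh (nseq i.+1 1%N) (nseq j.+1 1%N) = lsh (1%N :: nseq i 1%N) (1%N :: nseq j 1%N) by [].
rewrite lsh11 leps_cat leps_map leps_cat IHj (IHi j.+1).
rewrite [leps [seq _ | z <- _]]/leps big_map big1 ?addr0; last by move=> z _; rewrite coefXM.
by rewrite -natrD addSn -addnS binS.
Qed.

Definition toh (p : seq lmono) : hpoly := [seq (x.1, rev (rw x.2)) | x <- p].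

Definition lshp (p r : seq lmono) : seq lmono :=
  flatten [seq [seq (x.1 * y.1 * z.1, z.2) | z <- lsh x.2 y.2] | x <- p, y <- r].

(* [good n x]: a word of n letters in {hbar b, ba}. *)
Definition good (n : nat) (x : lmono) :=
  [&& size x.2 == n, all le1 x.2 & 'X^(count_mem 0%N x.2) %| x.1].

Lemma sh_toh n m p r : all (good n) p -> all (good m) r -> sh (toh p) (toh r) = toh (lshp p r).
Proof.
move=> hp hr; elim: p hp => [//|x p IH] /andP[/and3P[_ hx _] /IH IHp].
rewrite /sh /lshp !allpairs_cons /= !flatten_cat.
rewrite -[flatten [seq _ | x <- toh p, y <- toh r]]/(sh (toh p) (toh r)) IHp.
rewrite /toh map_cat; congr (_ ++ _).
elim: r hr {IH IHp} => [//|y r IH] /andP[/and3P[_ hy _] /IH IHr] /=.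
rewrite map_cat IHr; congr (_ ++ _).
by rewrite !revK rsh_lsh // -!map_comp.
Qed.

Lemma lshp_good n m p r : all (good n) p -> all (good m) r -> all (good (n + m)) (lshp p r).
Proof.
move=> /allP hp /allP hr; apply/allP => z /flattenP[s /allpairsPdep[x [y [/hp hx /hr hy ->]]]].
case/mapP => w hw ->; have /and3P[/eqP xs x1 xc] := hx; have /and3P[/eqP ys y1 yc] := hy.
have /allP/(_ _ hw) /= := lsh_size x1 y1; rewrite xs ys => ws.
have /allP/(_ _ hw) /= w1 := lsh_le1 x1 y1.
have /allP/(_ _ hw) /= wc := lsh_count x1 y1.
rewrite /good /= ws w1 /=; apply: dvdp_trans wc _.
by rewrite exprD !dvdp_mul.
Qed.

Lemma lshp_last1 n m p r : all (good n) p -> all (good m) r ->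
  all (fun z => last1 z.2) p -> all (fun z => last1 z.2) r ->
  all (fun z => last1 z.2) (lshp p r).
Proof.
move=> /allP hp /allP hr /allP lp /allP lr.
apply/allP => z /flattenP[s /allpairsPdep[x [y [hx hy ->]]]] /mapP[w hw ->] /=.
have /and3P[_ x1 _] := hp _ hx; have /and3P[_ y1 _] := hr _ hy.
by have /allP := lsh_last1 x1 y1 (lp _ hx) (lr _ hy); apply.
Qed.

Lemma good_ones n x : good n x -> 0%N \notin x.2 -> x.2 = nseq n 1%N.
Proof.
move=> /and3P[/eqP <- h _] h0; apply/all_pred1P/allP => k hk.
move/allP/(_ _ hk): h; rewrite /le1 /=; case: k hk => [|[|//]] // hk.
by rewrite hk in h0.
Qed.

Lemma good_coef0 n x : good n x -> 0%N \in x.2 -> x.1`_0 = 0.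
Proof.
move=> /and3P[_ _ hc]; rewrite -has_pred1 has_count.
case: (count _ _) hc => // k hc _; have /divpK <- := hc.
by rewrite exprS mulrCA coefXM.
Qed.

Lemma lshp_leps n m p r : all (good n) p -> all (good m) r ->
  leps (lshp p r) = 'C(n + m, n)%:R * leps p * leps r.
Proof.
move=> hp hr; elim: p hp => [|x p IH] /=.
  by rewrite /leps /lshp big_nil mulr0 mul0r.
move=> /andP[hx /IH IHp]; rewrite /lshp allpairs_cons flatten_cat leps_cat.
rewrite -[flatten [seq _ | x <- p, y <- r]]/(lshp p r) IHp.
rewrite /leps big_cons mulrDr mulrDl; congr (_ + _).
rewrite -!/(leps _) {IH IHp p}.
elim: r hr => [|y r IH]; first by rewrite /leps /= !big_nil mulr0.
move=> /= /andP[hy /IH IHr]; rewrite leps_cat IHr /leps big_cons mulrDr; congr (_ + _).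
rewrite big_map /=; under eq_bigr do rewrite !coef0M.
rewrite -mulr_sumr -/(leps _).
have [x0|/(good_ones hx)->] := boolP (0%N \in x.2).
  by rewrite (good_coef0 hx x0) !(mul0r, mulr0).
have [y0|/(good_ones hy)->] := boolP (0%N \in y.2).
  by rewrite (good_coef0 hy y0) !(mul0r, mulr0).
by rewrite lsh_leps; ring.
Qed.

(** This expresses p = c g_1^n modulo hbar: among the words of n letters in {hbar b, ba}, all except
    g_1^n carry a factor hbar, so [leps] is the coefficient of g_1^n at hbar = 0. *)
Definition is01 (n : nat) (c : rat) (p : hpoly) :=
  exists lp, [/\ p = toh lp, all (good n) lp & leps lp = c].

Lemma is01_one : is01 0 1 hone.
Proof.
exists [:: (1, [::])]; split=> //; first by rewrite /= /good /= dvdpp.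
by rewrite /leps big_seq1 coef1.
Qed.

Lemma is01_g1 : is01 1 1 (g 1).
Proof.
exists [:: (1, [:: 1%N])]; split=> //; last by rewrite /leps big_seq1 coef1.
by rewrite /= /good /= dvdpp.
Qed.

Lemma is01_e1 : is01 1 1 (e 1).
Proof.
exists [:: (1, [:: 1%N]); ('X, [:: 0%N])]; split=> //.
  by rewrite /= /good /= !addn0 expr0 expr1 !dvdpp.
by rewrite /leps big_cons big_seq1 coef1 coefX addr0.
Qed.

Lemma is01_sh n m c d p r : is01 n c p -> is01 m d r ->
  is01 (n + m) ('C(n + m, n)%:R * c * d) (sh p r).
Proof.
move=> [lp [-> hp <-]] [lr [-> hr <-]]; exists (lshp lp lr); split.
- exact: sh_toh hp hr.
- exact: lshp_good.
- exact: lshp_leps.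
Qed.

Lemma is01_shpow p n : is01 1 1 p -> is01 n (n`!%:R) (shpow p n).
Proof.
move=> hp; elim: n => [|n IH]; first exact: is01_one.
have := is01_sh hp IH; rewrite bin1 mulr1 -natrM add1n -factS. exact.
Qed.

Lemma is01_add n c d p r : is01 n c p -> is01 n d r -> is01 n (c + d) (hadd p r).
Proof.
move=> [lp [-> hp <-]] [lr [-> hr <-]]; exists (lp ++ lr); split.
- by rewrite /toh map_cat.
- by rewrite all_cat hp.
- exact: leps_cat.
Qed.

Lemma is01_scale n c (r : rat) p : is01 n c p -> is01 n (r * c) (hscale r%:P p).
Proof.
move=> [lp [-> hp <-]]; exists [seq (r%:P * x.1, x.2) | x <- lp]; split.
- by rewrite /hscale /toh -!map_comp.
- rewrite all_map; apply: sub_all hp => x /and3P[h1 h2 h3].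
  by apply/and3P; split=> //=; rewrite dvdp_mull.
- by rewrite /leps big_map mulr_sumr; apply: eq_bigr => x _; rewrite coefCM.
Qed.

Lemma is01_E1 s : is01 s 1 (E1 s).
Proof.
(* Modulo hbar, e_1 and g_1 agree, and each of the s + 1 summands contributes C(s, j) j! (s - j)! =
   s!. Their total (s + 1)! cancels the normalisation of E_{1^s}. *)
have <- : ((s.+1)`!%:R)^-1 * (s.+1)`!%:R = 1 :> rat.
  by rewrite mulVf // pnatr_eq0 -lt0n fact_gt0.
apply: is01_scale.
have H j : (j <= s)%N -> is01 s (s`!%:R) (sh (shpow (g 1) j) (shpow (e 1) (s - j))).
  move=> hj; have := is01_sh (is01_shpow j is01_g1) (is01_shpow (s - j) is01_e1).
  by rewrite subnKC // -!natrM -mulnA bin_fact.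
have {H} : forall js, all (fun j => (j <= s)%N) js -> is01 s ((size js)%:R * s`!%:R)
   (hsum [seq sh (shpow (g 1) j) (shpow (e 1) (s - j)) | j <- js]).
  elim=> [_|j js IH /= /andP[hj hjs]].
    by rewrite mul0r; exists [::]; split=> //; rewrite /leps big_nil.
  by rewrite -addn1 addnC natrD mulrDl mul1r; apply: is01_add; [exact: H|exact: IH].
move=> /(_ (iota 0 s.+1)); rewrite size_iota -natrM -factS; apply.
by apply/allP => j; rewrite mem_iota.
Qed.

Lemma shpow_g1 n : exists lp,
  [/\ shpow (g 1) n = toh lp, all (good n) lp & all (fun z => last1 z.2) lp].
Proof.
elim: n => [|n [lp [h1 h2 h3]]]; first by exists [:: (1, [::])]; rewrite /= /good /= dvdpp.
have hg : all (good 1) [:: (1, [:: 1%N])] by rewrite /= /good /= dvdpp.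
exists (lshp [:: (1, [:: 1%N])] lp); split.
- rewrite [LHS]/= -/(shpow _ _) h1; exact: (sh_toh hg h2).
- exact: (lshp_good hg h2).
- exact: (lshp_last1 hg h2).
Qed.

(** * Formal sums of words acting on power series by concatenation on the right *)

Section Semantics.
Variables (K : numFieldType) (q : K).
Hypothesis q_torsion : forall m, (0 < m)%N -> q ^+ m != 1.
Implicit Types (f : fps K) (ks ls : seq nat) (d nc : bool).

Local Notation P := (opa q).
Local Notation b := (fpsb K).
Local Notation h := (fpsC (hbar q)).

Definition opl (f : fps K) (l : letter) : fps K := if l is La then P f else b * f.
Definition Hop (p : hpoly) f : fps K := \sum_(x <- p) fpsC (heval q x.1) * foldl opl f x.2.
Definition Lop (p : seq lmono) f : fps K := \sum_(x <- p) fpsC (heval q x.1) * Jop q x.2 f.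

Lemma foldl_rw ks f : foldl opl f (rev (rw ks)) = Jop q ks f.
Proof.
rewrite foldl_rev; elim: ks => //= k ks IH; rewrite foldr_cat /= IH.
by elim: k => //= k ->.
Qed.

Lemma Hop_toh p f : Hop (toh p) f = Lop p f.
Proof. by rewrite /Hop big_map; apply: eq_bigr => x _; rewrite /= foldl_rw. Qed.

Lemma linop_foldl w : linop (fun f => foldl opl f w).
Proof.
elim: w => [|l w IH]; first by split.
apply: (@linop_comp _ (fun f => foldl opl f w) (fun f => opl f l)) => //.
by case: l; [exact: linop_opa|exact: linop_mul].
Qed.

Lemma linop_big I (r : seq I) (O : I -> fps K -> fps K) :
  (forall i, linop (O i)) -> linop (fun f => \sum_(i <- r) O i f).
Proof.
move=> hO; split=> [f g|c f].
  by rewrite -big_split; apply: eq_bigr => i _; case: (hO i) => ->.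
by rewrite mulr_sumr; apply: eq_bigr => i _; case: (hO i).
Qed.

Lemma linop_Hop p : linop (Hop p).
Proof.
apply: linop_big => x.
exact: (@linop_comp _ (fun f => fpsC (heval q x.1) * f) _ (linop_mul _) (linop_foldl _)).
Qed.

Lemma Hop_scale c p f : Hop (hscale c p) f = fpsC (heval q c) * Hop p f.
Proof.
rewrite /Hop big_map mulr_sumr; apply: eq_bigr => x _ /=.
by rewrite hevalM rmorphM mulrA.
Qed.

Lemma Hop_mul p r f : Hop (hmul p r) f = Hop r (Hop p f).
Proof.
rewrite [Hop p f]/Hop (linop_sum (linop_Hop r)) /Hop /hmul big_allpairs_dep /=.
apply: eq_bigr => x _; apply: eq_bigr => y _ /=.
rewrite foldl_cat hevalM rmorphM.
by case: (linop_foldl y.2) => _ ->; rewrite mulrA [_ * fpsC (heval q y.1)]mulrC.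
Qed.

Lemma Hop_one f : Hop hone f = f.
Proof. by rewrite /Hop big_seq1 /= heval1 rmorph1 mul1r. Qed.

Lemma Lop_cat p r f : Lop (p ++ r) f = Lop p f + Lop r f.
Proof. by rewrite /Lop big_cat. Qed.

Lemma Lop_cons k p f :
  Lop [seq (z.1, k :: z.2) | z <- p] f = iter k P (b * Lop p f).
Proof.
rewrite /Lop big_map mulr_sumr (linop_sum (linop_iter _ (linop_opa q))).
apply: eq_bigr => z _ /=; rewrite [b * (_ * _)]mulrCA.
by case: (linop_iter k (linop_opa q)) => _ ->.
Qed.

Lemma Lop_scale c (F : seq nat -> seq nat) p f :
  Lop [seq (c * z.1, F z.2) | z <- p] f = fpsC (heval q c) * Lop [seq (z.1, F z.2) | z <- p] f.
Proof.
rewrite /Lop !big_map mulr_sumr; apply: eq_bigr => z _ /=.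
by rewrite hevalM rmorphM mulrA.
Qed.

Lemma Lop_single c ks f : Lop [:: (c, ks)] f = fpsC (heval q c) * Jop q ks f.
Proof. by rewrite /Lop big_seq1. Qed.

(** Here f is the prefix to which the word is appended, and g_1 is shuffled into the appended part
    only. The product with L also shuffles g_1 into the prefix; those terms are L f - P(b f), where
    P(b f) puts g_1 right after the prefix. *)
Lemma lsh_g1 ls f : all le1 ls -> Lop (lsh [:: 1%N] ls) f =
  opL q * Jop q ls f - Jop q ls (opL q * f - P (b * f)).
Proof.
elim: ls => [|[|[|//]] ls IH] hl.
- by rewrite lsh_nil_r Lop_single heval1 rmorph1 mul1r /= subKr.
- by rewrite lsh10 Lop_cons /= (IH hl); ring.
have E := IH hl.
rewrite lsh11 Lop_cat Lop_cons Lop_cat E (Lop_scale 'X (fun l => [:: 1%N, 0%N & l])).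
rewrite /= !Lop_single heval1 rmorph1 !mul1r hevalX /=.
rewrite {1}/opL opa_RB ?fpsbM0 //.
rewrite -/(opL q) -!opaC -opaD -(linopB _ _ (linop_opa q)).
by congr (P _); ring.
Qed.

Lemma Lop_lshp p r f : Lop (lshp p r) f =
  \sum_(x <- p) \sum_(y <- r) fpsC (heval q (x.1 * y.1)) * Lop (lsh x.2 y.2) f.
Proof.
rewrite /lshp /Lop big_flatten /= big_allpairs_dep /=.
apply: eq_bigr => x _; apply: eq_bigr => y _; rewrite big_map mulr_sumr.
by apply: eq_bigr => z _; rewrite /= hevalM rmorphM /= mulrA.
Qed.

Definition Tser f : fps (fps K) :=
  fun n => fpsC (n`!%:R^-1) * Hop (shpow (g 1) n) f.

Lemma Tser0 f : Tser f 0%N = f.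
Proof. by rewrite /Tser invr1 rmorph1 mul1r Hop_one. Qed.

Lemma Tser_lin n : linop (fun f => Tser f n).
Proof. exact: (linop_comp (linop_mul _) (linop_Hop _)). Qed.

Lemma TserS n f :
  Tser f n.+1 *+ n.+1 = opL q * Tser f n - Tser (opL q * f - P (b * f)) n.
Proof.
have E : (n.+1`!%:R^-1 : K) *+ n.+1 = n`!%:R^-1.
  by rewrite factS natrM invfM -mulrnAl -mulr_natr mulVf ?pnatr_eq0 // mul1r.
rewrite /Tser -mulrnAl -raddfMn E [opL q * (_ * _)]mulrCA -mulrBr; congr (_ * _).
have [lp [h1 h2 _]] := shpow_g1 n.
have hg : all (good 1) [:: (1, [:: 1%N])] by rewrite /= /good /= dvdpp.
have -> : shpow (g 1) n.+1 = toh (lshp [:: (1, [:: 1%N])] lp).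
  by rewrite [LHS]/= -/(shpow _ _) h1; exact: (sh_toh hg h2).
rewrite h1 !Hop_toh Lop_lshp // big_seq1.
rewrite [Lop lp f]/Lop [Lop lp (_ - _)]/Lop mulr_sumr -sumrB.
apply: eq_big_seq => x /(allP h2) /and3P[_ hx _].
by rewrite mul1r lsh_g1 // mulrBr [in RHS]mulrCA.
Qed.

Lemma K_Jop01 d nc ls f : all le1 ls -> sp q (kp d nc) f ->
  sp q (kp (d || (0%N \in ls)) nc) (fpsC (hbar q ^+ count_mem 0%N ls) * Jop q ls f).
Proof.
move=> hl hf; elim: ls hl => [_|[|[|//]] ls IH] /=.
- by rewrite orbF rmorph1 mul1r.
- move=> /IH /K_hb; rewrite inE eqxx orbT add1n exprS rmorphM /=.
  have -> : h * fpsC (hbar q ^+ count_mem 0%N ls) * (b * Jop q ls f) =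
    h * (b * (fpsC (hbar q ^+ count_mem 0%N ls) * Jop q ls f)) by ring.
  by apply: K_weak.
move=> /IH /K_opab; rewrite inE add0n [b * _]mulrCA opaC.
by apply: K_weak.
Qed.

Lemma K_good n x d f : good n x -> sp q (kp d false) f ->
  sp q (kp (d || (0%N \in x.2)) false) (fpsC (heval q x.1) * Jop q x.2 f).
Proof.
move=> /and3P[_ h1 /divpK <-] hf; rewrite hevalM hevalXn rmorphM -mulrA.
by apply: K_scale; apply: K_Jop01.
Qed.

Lemma K_is01 n c d p f : is01 n c p -> sp q (kp d false) f -> sp q (kp d false) (Hop p f).
Proof.
move=> [lp [-> hp _]] hf; rewrite Hop_toh /Lop big_seq.
elim/big_ind: _ => [||x hx]; [exact: sp0|exact: spD|].
by move/allP/(_ _ hx): hp => /K_good /(_ hf); apply: K_weak => // ->.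
Qed.

Lemma is01_ones n p f : is01 n 1 p -> sp q (kp false false) f ->
  sp q (kp true false) (Hop p f - Jop q (nseq n 1%N) f).
Proof.
move=> [lp [-> hp hc]] hf; rewrite Hop_toh.
have -> : Jop q (nseq n 1%N) f = \sum_(x <- lp) fpsC (ratr x.1`_0) * Jop q (nseq n 1%N) f.
  by rewrite -mulr_suml -!rmorph_sum -/(leps lp) hc !rmorph1 mul1r.
rewrite /Lop -sumrB big_seq.
elim/big_ind: _ => [||x hx]; [exact: sp0|exact: spD|].
move/allP/(_ _ hx): hp => hx'.
have [x0|x0] := boolP (0%N \in x.2).
  rewrite (good_coef0 hx' x0) !rmorph0 mul0r subr0.
  by have := K_good hx' hf; rewrite x0.
rewrite (good_ones hx' x0) -mulrBl -(hevalC q) -rmorphB /=.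
have -> : heval q x.1 - heval q (x.1`_0)%:P = heval q (x.1 - (x.1`_0)%:P).
  by rewrite -[RHS](addrK (heval q (x.1`_0)%:P)) -hevalD subrK.
have /divpK <- : 'X %| x.1 - (x.1`_0)%:P.
  have -> : 'X = 'X - 0%:P :> {poly rat} by rewrite subr0.
  by rewrite dvdp_XsubCl; apply/rootP; rewrite horner_coef0 coefB coefC subrr.
rewrite hevalM hevalX rmorphM -mulrA; apply: K_scale; apply: (@K_hbar _ _ false).
have := @K_Jop01 false false (nseq n 1%N) f.
by rewrite all_nseq orbT count_nseq mul0n expr0 rmorph1 mul1r => /(_ isT hf); apply: K_weak.
Qed.

End Semantics.

(** * The submodule n and the elements E_k *)

Lemma wparse_rw ks : wparse (rev (rw ks)) = (0%N, rev ks).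
Proof.
pose F (st : nat * seq nat) l := match l with
  La => (st.1.+1, st.2) | Lb => (0%N, st.1 :: st.2) end.
have -> : wparse (rev (rw ks)) = foldl F (0%N, [::]) (rw ks).
  by rewrite -[rw ks in RHS]revK foldl_rev.
have aux k l u : foldl F (k, l) (nseq u La) = ((k + u)%N, l).
  by elim: u k => [|u IH] k; rewrite ?addn0 //= IH addnS.
suff H l : foldl F (0%N, l) (rw ks) = (0%N, catrev ks l) by rewrite H.
by elim: ks l => [//|k ks IH] l; rewrite rw_cons foldl_cat aux /= IH.
Qed.

(** The condition of n_0 read backwards: a block of size at least 2 that stands before a block 0 in
    the reversed list comes after it in the word. *)
Fixpoint has20 (ks : seq nat) : bool :=
  if ks is k :: ks' then ((2 <= k)%N && (0%N \in ks')) || has20 ks' else false.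

(* The condition [n_mono] for the word indexed by the reversed list [ks]. *)
Definition nq (x : lmono) : bool :=
  [&& x.2 != [::], (1 <= head 0%N x.2)%N, ('X^(count_mem 0%N x.2) %| x.1)%R & has20 x.2] ||
  [&& (x.2 == [::]) || (1 <= head 0%N x.2)%N & ('X^((count_mem 0%N x.2).+1) %| x.1)%R].

Lemma has20_rev ks :
  [exists i : 'I_(size ks), exists j : 'I_(size ks),
         [&& (i < j)%N, nth 0%N ks i == 0%N & (2 <= nth 0%N ks j)%N]] = has20 (rev ks).
Proof.
have -> : [exists i : 'I_(size ks), exists j : 'I_(size ks),
         [&& (i < j)%N, nth 0%N ks i == 0%N & (2 <= nth 0%N ks j)%N]] =
   has (fun j => has (fun i => [&& (i < j)%N, nth 0%N ks i == 0%N & (2 <= nth 0%N ks j)%N])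
     (iota 0 (size ks))) (iota 0 (size ks)).
  apply/existsP/hasP => [[i /existsP[j h]]|[j hj /hasP[i hi h]]].
    exists (j : nat); first by rewrite mem_iota add0n ltn_ord.
    by apply/hasP; exists (i : nat) => //; rewrite mem_iota add0n ltn_ord.
  move: hi hj; rewrite !mem_iota => /andP[_ hi] /andP[_ hj].
  by exists (Ordinal hi); apply/existsP; exists (Ordinal hj).
elim/last_ind: ks => [//|ks k IH].
have Ei n : iota 0 n.+1 = iota 0 n ++ [:: n] by rewrite -addn1 iotaD.
rewrite rev_rcons /= -IH size_rcons Ei has_cat [has _ [:: _]]/= orbF orbC.
congr (_ || _).
  rewrite has_cat /= ltnn /= orbF.
  rewrite mem_rev; apply/hasP/andP => [[j]|[hk /(nthP 0%N)[j hj hj0]]].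
    rewrite mem_iota !nth_rcons ltnn eqxx => /andP[_ hj] /and3P[_].
    rewrite hj => /eqP <- ->.
    by rewrite mem_nth.
  by exists j; rewrite ?mem_iota // !nth_rcons ltnn eqxx hj hk hj0.
apply: eq_in_has => j; rewrite mem_iota => /andP[_ hj].
rewrite has_cat /= [(size ks < j)%N]ltnNge (ltnW hj) /= orbF.
apply: eq_in_has => i; rewrite mem_iota => /andP[_ hi].
by rewrite !nth_rcons hi hj.
Qed.

Lemma n_monoE c w ks : wparse w = (0%N, rev ks) -> n_mono (c, w) = nq (c, ks).
Proof.
rewrite /n_mono /n0_mono /hH0_mono /nq /= => -> /=.
have -> : last 0%N (rev ks) = head 0%N ks.
  by case: ks => [//|k ks]; rewrite rev_cons last_rcons.
have -> : (rev ks == [::]) = (ks == [::]).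
  by rewrite -!size_eq0 size_rev.
by rewrite count_rev has20_rev revK.
Qed.

Section EK.
Variables (K : numFieldType) (q : K).
Hypothesis q_torsion : forall m, (0 < m)%N -> q ^+ m != 1.
Implicit Types (f : fps K) (ks ls : seq nat) (d nc : bool).

Local Notation P := (opa q).
Local Notation b := (fpsb K).
Local Notation h := (fpsC (hbar q)).

Lemma nq_hop k f : sp q (kp false false) f ->
  sp q nq (h * iter k.+1 P (b * f)).
Proof.
apply: (@sp_op _ _ _ _ (fun f => h * iter k.+1 P (b * f))).
  apply: (@linop_comp _ (fun f => h * f)); first exact: linop_mul.
  exact: (linop_comp (linop_iter _ (linop_opa q)) (linop_mul _)).
move=> [c ks] /andP[_ /=]; rewrite addn0 => hc.
have -> : h * P (iter k P (b * evmono q (c, ks))) = evmono q ('X * c, k.+1 :: ks).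
  rewrite (evmonoC q 'X (c, k.+1 :: ks)) hevalX evmono_b.
  have E i : iter i P (evmono q (c, 0%N :: ks)) = evmono q (c, i :: ks).
    by elim: i => [//|i IH]; rewrite iterS IH evmono_opa.
  by rewrite E evmono_opa.
apply: sp_mono; rewrite /nq /=; apply/orP; right.
by rewrite add0n exprS dvdp_mul2l ?polyX_eq0.
Qed.

Lemma nq_op2 k f : sp q (kp true false) f -> sp q nq (iter k.+2 P (b * f)).
Proof.
apply: (@sp_op _ _ _ _ (fun f => iter k.+2 P (b * f))).
  exact: (linop_comp (linop_iter _ (linop_opa q)) (linop_mul _)).
move=> [c ks] /andP[_ /=] hc.
have E i : iter i P (evmono q (c, 0%N :: ks)) = evmono q (c, i :: ks).
  by elim: i => [//|i IH]; rewrite iterS IH evmono_opa.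
rewrite evmono_b -!iterS E; apply: sp_mono; rewrite /nq /= !add0n.
case: (boolP (0%N \in ks)) hc => /= _ hc; first by rewrite addn0 in hc; rewrite hc.
by rewrite addn1 in hc; rewrite hc orbT.
Qed.

Lemma nq_opa f : sp q (kp true true) f -> sp q nq (P f).
Proof.
apply: sp_op => [|[c [|k ks]] /andP[//= _ hc]]; first exact: linop_opa.
rewrite evmono_opa; apply: sp_mono; rewrite /nq /= add0n.
case: k hc => [|k]; first by rewrite addn0 add1n => ->; rewrite orbT.
rewrite !inE add0n /=; case: (0%N \in ks) => /=.
  by rewrite addn0 => ->.
by rewrite addn1 => ->; rewrite orbT.
Qed.

Lemma nq_scale c f : sp q nq f -> sp q nq (fpsC (heval q c) * f).
Proof.
apply: sp_op => [|x hx]; first exact: linop_mul.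
rewrite -evmonoC; apply: sp_mono; move: hx; rewrite /nq /=.
case/orP => [/and4P[-> -> hc ->]|/andP[-> hc]]; apply/orP; [left|right].
  by rewrite dvdp_mull.
by rewrite dvdp_mull.
Qed.

Lemma has20_cat ls ks : has20 ks -> has20 (ls ++ ks).
Proof. by elim: ls => //= l ls IH /IH ->; rewrite orbT. Qed.

(** Appending letters cannot destroy a pair hbar b, g_k that is already present, nor use up a spare
    hbar; and since the appended word does not end in b, the result still converges. *)
Lemma nq_good n x f : good n x -> last1 x.2 -> sp q nq f ->
  sp q nq (fpsC (heval q x.1) * Jop q x.2 f).
Proof.
case: x => c ls /and3P[_ /= h1 h2] h3.
apply: (@sp_op _ _ _ _ (fun f => fpsC (heval q c) * Jop q ls f)).
  exact: (linop_comp (linop_mul _) (linop_Jop _ _)).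
move=> [c' ks] hx.
have -> : fpsC (heval q c) * Jop q ls (evmono q (c', ks)) = evmono q (c * c', ls ++ ks).
  rewrite /evmono /= Jop_cat; case: (linop_Jop q ls) => _ ->.
  by rewrite hevalM rmorphM mulrA.
apply: sp_mono; move: hx; rewrite /nq /= count_cat.
have hd0 : (1 <= head 0 ks)%N -> (1 <= head 0 (ls ++ ks))%N.
  by case: (ls) h3 => [//|l l'] /eqP /= ->.
case/orP => [/and4P[hn hd hc h20]|/andP[hd hc]]; apply/orP; [left|right].
  rewrite hd0 // exprD dvdp_mul // has20_cat // !andbT.
  by case: (ks) hn; case: (ls).
rewrite -addnS exprD dvdp_mul // andbT.
by case: (ls) h3 hd hd0 => [//|l l'] /eqP /= ->.
Qed.

Lemma Hop_e k f : Hop q (e k) f = iter k P (b * f) + h * iter k.-1 P (b * f).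
Proof.
have E i : foldl (opl q) (b * f) (nseq i La) = iter i P (b * f).
  elim: i (b * f) => [//|i IH] u /=; rewrite IH.
  by rewrite -iterSr.
by rewrite /Hop big_cons big_seq1 /= !E heval1 rmorph1 mul1r hevalX.
Qed.

Lemma Hop_E10 f : Hop q (E1 0) f = f.
Proof.
rewrite /E1 Hop_scale hevalC /Hop /= big_seq1 /= !mulr1 heval1 !rmorph1 mul1r.
by rewrite mul1r.
Qed.

Lemma K_ones s d f : sp q (kp d false) f -> sp q (kp d false) (Jop q (nseq s 1%N) f).
Proof.
by move=> hf; elim: s => [//|s IH]; have := K_opab IH; apply: K_weak.
Qed.

Lemma K_iter k d f : sp q (kp d false) f -> sp q (kp d false) (iter k.+1 P (b * f)).
Proof.
move=> hf; apply: (@K_weak _ _ d true) => //.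
elim: k => [|k IH]; first exact: K_opab hf.
by rewrite iterS; apply: K_opa.
Qed.

(** Induction on the index with two accumulators for the prefix already read, [f] on the side of E
    and [f0] on the side of g, which agree modulo hbar. Only the last block, of size at least 2,
    turns this agreement into membership in n. *)
Lemma Ego_spec ks s f f0 : all (fun k => 0 < k)%N ks -> (2 <= last 0 ks)%N ->
  sp q (kp false false) f -> sp q (kp true false) (f - f0) ->
  sp q nq (Hop q (Ego s ks) f - Jop q (rev ks) (Jop q (nseq s 1%N) f0)).
Proof.
elim: ks s f f0 => [//|k ks IH] s f f0 /= /andP[k0 hks] hl hf hff0.
rewrite rev_cons -cats1 Jop_cat.
case: eqP => [k1|k1].
  have {}hl : (2 <= last 0 ks)%N by move: hl; rewrite k1; case: (ks).
  rewrite k1.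
  exact: (IH s.+1).
case: k k0 k1 hl => [|[|k]] // _ _ hl.
rewrite !Hop_mul.
set u := Hop q (E1 s) f; set u0 := Jop q (nseq s 1%N) f0.
have hu : sp q (kp false false) u by apply: (K_is01 (is01_E1 s)).
have hd1 : sp q (kp true false) (u - u0).
  have -> : u - u0 = (u - Jop q (nseq s 1%N) f) + Jop q (nseq s 1%N) (f - f0).
    by rewrite (linopB _ _ (linop_Jop _ _)) addrA subrK.
  by apply: spD; [exact: (is01_ones (is01_E1 s))|exact: K_ones].
(* Since e_k = g_k + hbar g_{k-1}, the first term inherits its hbar from [u - u0], and the second
   carries one explicitly. *)
have E : Hop q (e k.+2) u - Jop q [:: k.+2] u0 =
    iter k.+2 P (b * (u - u0)) + h * iter k.+1 P (b * u).
  rewrite Hop_e /= -!iterS addrAC; congr (_ + _).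
  rewrite mulrBr; symmetry; apply: (linopB _ _ (linop_iter k.+2 (linop_opa q))).
case: ks hl hks IH => [|k' ks] hl hks IH.
  rewrite Hop_E10 E /=; apply: spD; first exact: nq_op2.
  exact: nq_hop.
apply: (IH 0%N (Hop q (e k.+2) u) (Jop q [:: k.+2] u0)) => //.
  by rewrite Hop_e; apply: spD; [exact: K_iter|apply: K_weak (K_hbar (K_iter k hu))].
by rewrite E; apply: spD; [exact: K_iter|exact: K_hbar (K_iter k hu)].
Qed.

Lemma Hop_gk ks f : Hop q (gk ks) f = Jop q (rev ks) f.
Proof.
elim: ks f => [|k ks IH] f; first exact: Hop_one.
rewrite /gk /= Hop_mul IH rev_cons -cats1 Jop_cat; congr Jop.
rewrite /Hop big_seq1 /= heval1 rmorph1 mul1r.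
by elim: k (b * f) => [//|i IHi] u /=; rewrite IHi -iterSr.
Qed.

Lemma Hop_hpow_g1 n f : Hop q (hpow (g 1) n) f = Jop q (nseq n 1%N) f.
Proof.
elim: n f => [|n IH] f; first exact: Hop_one.
rewrite /= -/(hpow _ _) Hop_mul IH.
have -> : Hop q (g 1) f = P (b * f) by rewrite /Hop big_seq1 /= heval1 rmorph1 mul1r.
by elim: n {IH} => //= n ->.
Qed.

Lemma nq_Tser n f : sp q nq f -> sp q nq (Tser q f n).
Proof.
move=> hf; have [lp [h1 h2 h3]] := shpow_g1 n.
rewrite /Tser h1 Hop_toh.
have -> : n`!%:R^-1 = heval q (n`!%:R^-1)%:P by rewrite hevalC fmorphV rmorph_nat.
apply: nq_scale; rewrite /Lop big_seq.
elim/big_ind: _ => [||x hx]; [exact: sp0|exact: spD|].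
by apply: nq_good hf; [exact: (allP h2)|exact: (allP h3 _ hx)].
Qed.

Lemma Hop_Ek_G ks n : Hop q (hmul (Ek ks) (hscale ((n`!%:R)^-1 : rat)%:P (shpow (g 1) n))) 1 =
  Tser q (Hop q (Ek ks) 1) n.
Proof. by rewrite Hop_mul Hop_scale hevalC fmorphV rmorph_nat. Qed.

(** Admissibility enters here: with last entry at least 2, removing the last a leaves a word that
    still ends in some g_k with k >= 1, hence a nonconstant element of C<A>. *)
Lemma admissible_opa ks : admissible ks -> ks != [::] -> exists f,
  [/\ Jop q (rev ks) 1 = P f, sp q (kp false true) f & f 0%N = 0].
Proof.
move=> /andP[h0 h1] hn; rewrite (negbTE hn) /= in h1.
have h0r : all (fun k => 0 < k)%N (rev ks) by rewrite all_rev.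
have : (2 <= head 0 (rev ks))%N.
  by case/lastP: (ks) h1 => [//|s x]; rewrite last_rcons rev_rcons.
case: (rev ks) h0r => [//|[|[|k]] rks] // h0r _.
have E : Jop q (k.+1 :: rks) 1 = wJ q (k.+1 :: rks).
  rewrite /wJ /evmono /=; have -> : count_mem 0%N rks = 0%N.
    apply/eqP; rewrite -leqn0 leqNgt -has_count has_pred1.
    by apply/negP => z; have := allP h0r 0%N; rewrite inE z orbT => /(_ isT).
  by rewrite heval1 rmorph1 mul1r.
exists (Jop q (k.+1 :: rks) 1); split=> //; rewrite E.
  by have := wJ_sp q (k.+1 :: rks); apply: K_weak.
exact: wJ_const0.
Qed.

Lemma Ek_Tser ks n : admissible ks -> ks != [::] ->
  sp q nq (Tser q (Hop q (Ek ks) 1) n - Tser q (Jop q (rev ks) 1) n).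
Proof.
move=> /andP[h0 h1] hn; rewrite (negbTE hn) /= in h1.
rewrite -(linopB _ _ (Tser_lin q n)); apply: nq_Tser.
apply: (@Ego_spec ks 0%N 1 1) => //; first exact: K_one.
by rewrite subrr; exact: sp0.
Qed.

End EK.

(** * Harmonic products and Newton's identities *)

(* Terms of the harmonic (stuffle) product of the word [ks] with g_n. *)
Fixpoint stuffle1 (n : nat) (ks : seq nat) : seq (seq nat) :=
  if ks is k :: ks' then
    [:: n :: k :: ks', (n + k)%N :: ks' & [seq k :: r | r <- stuffle1 n ks']]
  else [:: [:: n]].

Lemma stuffle1_count n ks r : (0 < n)%N -> r \in stuffle1 n ks ->
  (count_mem 0%N r <= count_mem 0%N ks)%N.
Proof.
move=> n0; elim: ks r => [|k ks IH] r /=.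
  by rewrite inE => /eqP -> /=; rewrite (gtn_eqF n0).
rewrite !inE => /or3P[/eqP ->|/eqP ->|/mapP[r' /IH h ->]] /=.
- by rewrite (gtn_eqF n0).
- by rewrite addn_eq0 (gtn_eqF n0) leq_addl.
- by rewrite leq_add2l.
Qed.

Lemma stuffle1_head n ks r : (0 < n)%N -> (ks == [::]) || (1 <= head 0 ks)%N ->
  r \in stuffle1 n ks -> (1 <= head 0 r)%N.
Proof.
move=> n0; case: ks => [_|k ks /= k0]; first by rewrite inE => /eqP ->.
rewrite !inE => /or3P[/eqP ->|/eqP ->|/mapP[r' _ ->]] //=.
by rewrite addn_gt0 n0.
Qed.

(** A pair can be lost only when g_n merges with a letter hbar b, as n + 0 = n. Then one block 0
    disappears while the coefficient stays, which leaves a spare hbar. *)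
Lemma stuffle1_has20 n ks r : (0 < n)%N -> has20 ks -> r \in stuffle1 n ks ->
  has20 r || (count_mem 0%N r < count_mem 0%N ks)%N.
Proof.
move=> n0; elim: ks r => [|k ks IH] r //= hk.
rewrite !inE => /or3P[/eqP ->|/eqP ->|/mapP[r' hr ->]] /=.
- by rewrite hk !orbT.
- case: k hk => [|k] /=; first by move=> ->; rewrite orbT.
  by case/orP=> [/andP[hk ->]|->]; rewrite ?orbT // addnS !ltnS ltn_addl.
have hc := stuffle1_count n0 hr.
rewrite ltn_add2l; case/orP: hk => [/andP[-> hks]|/IH/(_ hr)/orP[->|->]]; rewrite ?orbT //=.
move: hks; rewrite -!has_pred1 !has_count => hks.
by case: (ltngtP (count_mem 0%N r') (count_mem 0%N ks)) hc => // [|->] _;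
  rewrite ?orbT // hks.
Qed.

Lemma stuffle1_nq n c ks r : (0 < n)%N -> nq (c, ks) -> r \in stuffle1 n ks -> nq (c, r).
Proof.
move=> n0 h hr; have hc := stuffle1_count n0 hr.
have hd : (1 <= head 0 r)%N.
  apply: (stuffle1_head n0 _ hr).
  by case/orP: h => [/and4P[_ /= -> _ _]|/andP[]] //; rewrite orbT.
have hn : r != [::] by case: (r) hd.
rewrite /nq /= hd hn orbT /=.
case/orP: h => [/and4P[_ _ /= h1 h2]|/andP[_ /= h1]].
  case/orP: (stuffle1_has20 n0 h2 hr) => h3.
    by rewrite h3 andbT (dvdp_trans _ h1) ?dvdp_exp2l.
  by rewrite orbC (dvdp_trans _ h1) ?dvdp_exp2l.
by rewrite orbC (dvdp_trans _ h1) ?dvdp_exp2l.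
Qed.

Section PartialSums.
Variable K : comNzRingType.
Implicit Types f g : fps K.

Definition psum f (M : nat) : K := \sum_(m < M) f m.

Lemma psum0 f : psum f 0 = 0. Proof. exact: big_ord0. Qed.
Lemma psumS f M : psum f M.+1 = psum f M + f M. Proof. exact: big_ord_recr. Qed.
Lemma psumD f g M : psum (f + g) M = psum f M + psum g M.
Proof. exact: big_split. Qed.
Lemma psumC c f M : psum (fpsC c * f) M = c * psum f M.
Proof. by rewrite /psum mulr_sumr; apply: eq_bigr => m _; rewrite fpsCM. Qed.
Lemma psum_sum I (r : seq I) (F : I -> fps K) M :
  psum (\sum_(i <- r) F i) M = \sum_(i <- r) psum (F i) M.
Proof.
rewrite /psum exchange_big /=; apply: eq_bigr => m _.
by rewrite fps_sumE.
Qed.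

Lemma psumM f g M : psum (f * g) M = \sum_(i < M) f i * psum g (M - i).
Proof.
elim: M => [|M IH]; first by rewrite psum0 big_ord0.
rewrite psumS IH fpsME big_ord_recr [in RHS]big_ord_recr /= addrA -big_split /=.
rewrite subnn subSn // subnn psumS psum0 add0r; congr (_ + _).
by apply: eq_bigr => i _; rewrite -mulrDr subSn ?psumS // ltnW.
Qed.
End PartialSums.

Section PowerSeriesExp.
Variable K : numFieldType.
Implicit Types A : fps K.

Definition pexp A : fps K := fun N => \sum_(j < N.+1) (j`!%:R)^-1 * (A ^+ j) N.

Lemma pexpE A n k : A 0%N = 0 -> (k <= n)%N ->
  pexp A k = (\sum_(j < n.+1) fpsC (j`!%:R^-1) * A ^+ j) k.
Proof.
move=> A0 lekn; rewrite fps_sumE /pexp.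
rewrite (big_ord_widen n.+1 (fun j => j`!%:R^-1 * (A ^+ j) k)) // big_mkcond /=.
apply: eq_bigr => i _; rewrite fpsCM; case: ltnP => // lt.
by rewrite fpsX_lt // mulr0.
Qed.

Lemma pexp_deriv A : A 0%N = 0 -> fps_deriv (pexp A) = fps_deriv A * pexp A.
Proof.
move=> A0; apply/funext => n.
rewrite /fps_deriv (@pexpE A n.+1) // fps_sumE big_ord_recl expr0 mulr1 /=.
rewrite {1}/fpsC /= add0r -sumrMnl.
transitivity (\sum_(j < n.+1) (fps_deriv A * (fpsC (j`!%:R^-1) * A ^+ j)) n).
  apply: eq_bigr => j _; rewrite /bump /= add1n fpsCM -mulrnAr.
  rewrite -[_ *+ n.+1]/(fps_deriv (A ^+ j.+1) n) fps_derivX fpsMnE.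
  rewrite [RHS](_ : _ = j`!%:R^-1 * (fps_deriv A * A ^+ j) n); last by rewrite mulrCA fpsCM.
  by rewrite mulrnAr -mulrnAl factS natrM invfM -mulrnAl -[_^-1 *+ _]mulr_natr mulVf
    ?pnatr_eq0 // mul1r.
rewrite -(fps_sumE _ _ (fun j : 'I_n.+1 => fps_deriv A * (fpsC (j`!%:R^-1) * A ^+ j))).
rewrite -mulr_sumr !fpsME; apply: eq_bigr => i _.
by rewrite -pexpE // leq_subr.
Qed.
End PowerSeriesExp.

Section HarmonicSums.
Variables (K : numFieldType) (q : K).
Implicit Types (ks : seq nat).

Definition Js ks := psum (Jop q ks 1).

Lemma iter_opa k (f : fps K) m : iter k (opa q) f m = xcoef q m ^+ k * f m.
Proof. by elim: k => [|k IH]; rewrite ?mul1r // iterS /opa IH exprS mulrA. Qed.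

Lemma Js0 ks : Js ks 0 = 0. Proof. exact: psum0. Qed.

Lemma Js_cons k ks M : Js (k :: ks) M = \sum_(m < M) xcoef q m ^+ k * Js ks m.
Proof. by apply: eq_bigr => m _; rewrite /= iter_opa fpsbME. Qed.

Lemma Js_consS k ks M : Js (k :: ks) M.+1 = Js (k :: ks) M + xcoef q M ^+ k * Js ks M.
Proof. by rewrite !Js_cons big_ord_recr. Qed.

Lemma Js_nil M : Js [::] M = (0 < M)%:R.
Proof.
case: M => [|M]; first exact: psum0.
by rewrite /Js /psum big_ord_recl big1 ?addr0.
Qed.

(** [Js [::] 0] is an empty sum, hence 0 and not 1; the factor [xcoef q 0 = 0] hides this. *)
Lemma xcoef_nil n M : (0 < n)%N -> xcoef q M ^+ n * Js [::] M = xcoef q M ^+ n.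
Proof.
case: n => // n _; rewrite Js_nil; case: M => [|M]; last by rewrite mulr1.
by rewrite xcoef0 exprS !mul0r.
Qed.

(** Raising M by one adds the terms in which the outermost index of the word, that of g_n, or both
    equal M; these are the three branches of [stuffle1]. *)
Lemma Js_stuffle n ks M : (0 < n)%N ->
  Js ks M * Js [:: n] M = \sum_(r <- stuffle1 n ks) Js r M.
Proof.
move=> n0; elim: ks M => [|k ks IHk] M.
  rewrite /= big_seq1 Js_nil; case: M => [|M]; last by rewrite mul1r.
  by rewrite mul0r [RHS]psum0.
elim: M => [|M IHM].
  by rewrite {1}/Js psum0 mul0r big1 // => r _; rewrite [LHS]psum0.
move: IHM; rewrite /= !big_cons !big_map => IHM.
rewrite !Js_consS xcoef_nil //.
under eq_bigr do rewrite Js_consS.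
rewrite big_split /= -mulr_sumr -IHk exprD.
transitivity (Js (k :: ks) M * Js [:: n] M + (xcoef q M ^+ n * Js (k :: ks) M
  + xcoef q M ^+ k * (Js ks M * Js [:: n] M) + xcoef q M ^+ n * xcoef q M ^+ k * Js ks M)).
  by ring.
by rewrite IHM; ring.
Qed.

Definition elemS M : fps K := fun n => Js (nseq n 1%N) M.
Definition newtonS M : fps K := fun n => (-1) ^+ n * Js [:: n.+1] M.

(** A new variable x multiplies the generating series of elementary symmetric sums by 1 + x X, and
    so adds x / (1 + x X), here [G], to its logarithmic derivative. At M = 1 the only variable is
    [xcoef q 0 = 0]. *)
Lemma newton M : (0 < M)%N -> fps_deriv (elemS M) = newtonS M * elemS M.
Proof.
case: M => // M _; elim: M => [|M IH].
  have e1 : elemS 1 = 1.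
    apply/funext => -[|n]; rewrite /elemS; first by rewrite [LHS]Js_nil.
    by rewrite /= Js_consS !Js0 mulr0 addr0.
  have n1 : newtonS 1 = 0.
    apply/funext => n; rewrite /newtonS Js_consS Js0 xcoef_nil //.
    by rewrite xcoef0 exprS mul0r addr0 mulr0.
  by rewrite e1 n1 fps_deriv1 mul0r.
set x := xcoef q M.+1.
have eE : elemS M.+2 = elemS M.+1 + fpsC x * (@fpsX _ * elemS M.+1).
  apply/funext => -[|n]; rewrite fpsDE fpsCM ?fpsXM0 ?fpsXMS ?mulr0 ?addr0.
    by rewrite /elemS /= !Js_nil.
  by rewrite /elemS /= Js_consS expr1.
pose G : fps K := fun n => (-1) ^+ n * x ^+ n.+1.
have nE : newtonS M.+2 = newtonS M.+1 + G.
  by apply/funext => n; rewrite fpsDE /newtonS /G Js_consS xcoef_nil // mulrDr.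
have GE : G + fpsC x * (@fpsX _ * G) = fpsC x.
  apply/funext => -[|n]; rewrite fpsDE fpsCM ?fpsXM0 ?fpsXMS.
    by rewrite mulr0 addr0 /G mul1r expr1.
  by rewrite /G /fpsC /= !exprS; ring.
have dX : fps_deriv (@fpsX K) = 1.
  apply/funext => -[|n]; rewrite /fps_deriv /fpsX //=.
  by rewrite mul0rn.
have dC : fps_deriv (fpsC x) = 0.
  by apply/funext => n; rewrite /fps_deriv /fpsC /= mul0rn.
rewrite nE eE fps_derivD !fps_derivM IH dX dC.
set N := newtonS _; set E := elemS _.
rewrite [RHS](_ : _ = N * (E + fpsC x * (@fpsX _ * E)) + (G + fpsC x * (@fpsX _ * G)) * E).
  by rewrite GE; ring.
by ring.
Qed.

End HarmonicSums.

(** * Sums of complex series *)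

Section ComplexLimits.
Variable R : realType.
Local Notation C := ((R[i])^o).
Implicit Types (f g : fps R[i]) (z : R[i]).

Definition tends (u : nat -> R[i]) (l : R[i]) : Prop := (fun n => u n : C) @ \oo --> (l : C).

Lemma tendsD u v a b : tends u a -> tends v b -> tends (fun n => u n + v n) (a + b).
Proof. exact: cvgD. Qed.
Lemma tendsM u v a b : tends u a -> tends v b -> tends (fun n => u n * v n) (a * b).
Proof. exact: (@cvgM R[i]). Qed.
Lemma tends_cst a : tends (fun n => a) a. Proof. exact: cvg_cst. Qed.
Lemma tends_lim u a : tends u a -> limn (fun n => u n : C) = a.
Proof. by apply: cvg_lim; exact: norm_hausdorff. Qed.
Lemma tends_unique u a b : tends u a -> tends u b -> a = b.
Proof. by move=> /tends_lim <- /tends_lim <-. Qed.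
Lemma tendsS u a : tends (fun n => u n.+1) a -> tends u a.
Proof. by rewrite /tends -[X in _ -> X]cvg_shiftS. Qed.
Lemma tends_shift u a : tends u a -> tends (fun n => u n.+1) a.
Proof. by rewrite /tends -[X in X -> _]cvg_shiftS. Qed.
(** The index 0 is left out because at M = 0 the partial sum of the series 1 is 0, while [Ssum] of
    the empty word is 1. *)
Lemma tends_ext u v a : (forall n, (0 < n)%N -> u n = v n) -> tends u a -> tends v a.
Proof.
move=> h /tends_shift hu; apply: tendsS.
by have <- : (fun n => u n.+1) = (fun n => v n.+1) by apply/funext => n; apply: h.
Qed.
Lemma tends_real (u : nat -> R) (a : R) : u @ \oo --> a -> tends (fun n => (u n)%:C%C) (a%:C%C).
Proof.
move=> h; apply/cvgrPdist_lt => eps; case: eps => e e'; rewrite ltcE /= => /andP[/eqP -> e0].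
have /cvgrPdist_lt/(_ _ e0) := h; apply: filterS => n hn.
by rewrite -rmorphB normc_def /= ltcE /= eqxx /= expr0n addr0 sqrtr_sqr; exact: hn.
Qed.
Lemma tends_sum I (r : seq I) (u : I -> nat -> R[i]) (a : I -> R[i]) :
  (forall i, tends (u i) (a i)) -> tends (fun n => \sum_(i <- r) u i n) (\sum_(i <- r) a i).
Proof.
move=> h; elim: r => [|i r IH].
  rewrite big_nil; have -> : (fun n => \sum_(i <- [::]) u i n) = (fun=> 0).
    by apply/funext => n; rewrite big_nil.
  exact: tends_cst.
rewrite big_cons.
have -> : (fun n => \sum_(i <- i :: r) u i n) = (fun n => u i n + \sum_(i <- r) u i n).
  by apply/funext => n; rewrite big_cons.
exact: (tendsD (h i) IH).
Qed.

(** The modulus as a real number: the norm of z is itself an element of [R[i]], whereas monotone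
    convergence takes place in [R]. *)
Definition nrm z : R := Normc.normc z.

Lemma nrmE z : `|z| = (nrm z)%:C%C.
Proof. by []. Qed.
Lemma nrm_ge0 z : 0 <= nrm z.
Proof. by case: z => x y; rewrite /nrm /= sqrtr_ge0. Qed.
Lemma nrmM : {morph nrm : x y / x * y}.
Proof. exact: Normc.normcM. Qed.
Lemma nrmD x y : nrm (x + y) <= nrm x + nrm y.
Proof. exact: le_normcD. Qed.
Lemma nrm0 : nrm 0 = 0. Proof. exact: Normc.normc0. Qed.
Lemma nrm1 : nrm 1 = 1. Proof. exact: Normc.normc1. Qed.
Lemma nrmV z : nrm z^-1 = (nrm z)^-1. Proof. exact: Normc.normcV. Qed.
Lemma nrmX z n : nrm (z ^+ n) = nrm z ^+ n.
Proof. by elim: n => [|n IH]; rewrite ?nrm1 // !exprS nrmM IH. Qed.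
Lemma nrmB_ge x y : nrm x - nrm y <= nrm (x - y).
Proof. by rewrite lerBlDr; apply: le_trans (nrmD _ _); rewrite subrK. Qed.
Lemma nrm_Re z : `|complex.Re z| <= nrm z.
Proof.
case: z => x y; rewrite /nrm /= -sqrtr_sqr ler_sqrt ?addr_ge0 ?sqr_ge0 //.
by rewrite lerDl sqr_ge0.
Qed.
Lemma nrm_Im z : `|complex.Im z| <= nrm z.
Proof.
case: z => x y; rewrite /nrm /= -sqrtr_sqr ler_sqrt ?addr_ge0 ?sqr_ge0 //.
by rewrite lerDr sqr_ge0.
Qed.
Lemma nrm_sum I (r : seq I) (F : I -> R[i]) : nrm (\sum_(i <- r) F i) <= \sum_(i <- r) nrm (F i).
Proof.
elim: r => [|i r IH]; first by rewrite !big_nil nrm0.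
by rewrite !big_cons; apply: le_trans (nrmD _ _) _; rewrite lerD2l.
Qed.

(** * Absolutely summable series and their products *)

Definition nf f : fps R := fun m => nrm (f m).

Definition abs_summable f := exists B : R, forall M, psum (nf f) M <= B.

Lemma psum_mono (a : fps R) M M' : (forall m, 0 <= a m) -> (M <= M')%N ->
  psum a M <= psum a M'.
Proof.
move=> a0 /subnK <-; elim: (M' - M)%N => [//|k IH].
by rewrite addSn psumS (le_trans IH) // lerDl.
Qed.

Lemma nf_ge0 f m : 0 <= nf f m. Proof. exact: nrm_ge0. Qed.

Lemma psum_bounded_cvg (a : fps R) (B : R) : (forall m, 0 <= a m) ->
  (forall M, psum a M <= B) -> cvgn (psum a).
Proof.
move=> a0 hB; apply: nondecreasing_is_cvgn.
  by move=> n m; apply: psum_mono.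
by exists B => _ [M _ <-]; apply: hB.
Qed.

Lemma psum_dom_cvg (a b : fps R) (B : R) : (forall m, `|a m| <= b m) ->
  (forall M, psum b M <= B) -> cvgn (psum a).
Proof.
move=> hab hB.
have b0 m : 0 <= b m by apply: le_trans (hab m).
have h1 : cvgn (psum b) by apply: psum_bounded_cvg hB.
have h2 : cvgn (psum (a + b)).
  apply: (@psum_bounded_cvg _ (B + B)) => m.
    by rewrite fpsDE -lerBlDr sub0r; have := hab m; rewrite ler_norml => /andP[].
  rewrite psumD lerD //; apply: le_trans (hB m).
  by apply: ler_sum => i _; apply: le_trans (hab i); apply: ler_norm.
have -> : psum a = psum (a + b) - psum b.
  by apply/funext => M; rewrite fctE psumD addrK.
exact: is_cvgB.
Qed.

Lemma abs_summable_conv f : abs_summable f -> exists l, tends (psum f) l.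
Proof.
move=> [B hB].
have /cvg_ex[/= x hx] : cvgn (psum (fun m => complex.Re (f m) : R) : nat -> R).
  by apply: (@psum_dom_cvg _ (nf f) B) => // m; apply: nrm_Re.
have /cvg_ex[/= y hy] : cvgn (psum (fun m => complex.Im (f m) : R) : nat -> R).
  by apply: (@psum_dom_cvg _ (nf f) B) => // m; apply: nrm_Im.
exists (x%:C%C + 'i%C * y%:C%C).
have -> : psum f = fun M => ((psum (fun m => complex.Re (f m) : R) M)%:C%C +
    'i%C * (psum (fun m => complex.Im (f m) : R) M)%:C%C).
  apply/funext => M; rewrite /psum !rmorph_sum mulr_sumr -big_split.
  by apply: eq_bigr => m _ /=; rewrite -complexE.
apply: tendsD; first exact: tends_real.
by apply: tendsM; [exact: tends_cst|exact: tends_real].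
Qed.

Definition Zs f : R[i] := limn (psum f : nat -> C).

Lemma Zs_conv f : abs_summable f -> tends (psum f) (Zs f).
Proof. by move=> /abs_summable_conv[l hl]; rewrite /Zs (tends_lim hl). Qed.

Lemma Zs_eq f l : tends (psum f) l -> Zs f = l.
Proof. exact: tends_lim. Qed.

Lemma abs_summableD f g : abs_summable f -> abs_summable g -> abs_summable (f + g).
Proof.
move=> [A hA] [B hB]; exists (A + B) => M; apply: le_trans (lerD (hA M) (hB M)).
by rewrite -psumD; apply: ler_sum => m _; apply: nrmD.
Qed.

Lemma abs_summableC c f : abs_summable f -> abs_summable (fpsC c * f).
Proof.
move=> [A hA]; exists (nrm c * A) => M.
apply: le_trans (ler_wpM2l (nrm_ge0 c) (hA M)).
by rewrite -psumC; apply: ler_sum => m _; rewrite /nf !fpsCM nrmM.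
Qed.

Lemma abs_summable0 : abs_summable 0.
Proof. by exists 0 => M; rewrite /psum big1 // => m _; rewrite /nf nrm0. Qed.

Lemma abs_summable1 : abs_summable 1.
Proof.
exists 1 => M; case: M => [|M]; first by rewrite psum0.
by rewrite /psum big_ord_recl big1 => [|m _]; rewrite /nf ?nrm1 ?nrm0 ?addr0.
Qed.

Lemma abs_summable_sum I (r : seq I) (F : I -> fps R[i]) :
  (forall i, abs_summable (F i)) -> abs_summable (\sum_(i <- r) F i).
Proof. by move=> h; elim/big_ind: _ => //; [exact: abs_summable0|exact: abs_summableD]. Qed.

Lemma nf_mul_le f g M : psum (nf (f * g)) M <= psum (nf f * nf g) M.
Proof.
apply: ler_sum => m _; apply: le_trans (nrm_sum _ _) _.
by apply: ler_sum => i _; rewrite nrmM.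
Qed.

Lemma psum_mul_le (a b : fps R) M : (forall m, 0 <= a m) -> (forall m, 0 <= b m) ->
  psum (a * b) M <= psum a M * psum b M.
Proof.
move=> a0 b0; rewrite psumM {2}/psum mulr_suml; apply: ler_sum => i _.
by rewrite ler_wpM2l // psum_mono // leq_subr.
Qed.

Lemma psum_ge0 (a : fps R) M : (forall m, 0 <= a m) -> 0 <= psum a M.
Proof. by move=> a0; apply: sumr_ge0. Qed.

(** The triangle i + j < 2 M contains the square i, j < M. *)
Lemma psum_mul_ge (a b : fps R) M : (forall m, 0 <= a m) -> (forall m, 0 <= b m) ->
  psum a M * psum b M <= psum (a * b) (M * 2).
Proof.
move=> a0 b0; rewrite psumM {1}/psum mulr_suml.
rewrite (big_ord_widen (M * 2) (fun i => a i * psum b M)) ?leq_pmulr // big_mkcond.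
apply: ler_sum => i _; case: ltnP => hi; last by rewrite mulr_ge0 ?psum_ge0.
by rewrite ler_wpM2l // psum_mono //; lia.
Qed.

Lemma abs_summableM f g : abs_summable f -> abs_summable g -> abs_summable (f * g).
Proof.
move=> [A hA] [B hB]; exists (A * B) => M.
apply: le_trans (nf_mul_le _ _ _) _; apply: le_trans (psum_mul_le _ (nf_ge0 f) (nf_ge0 g)) _.
by apply: ler_pM => //; apply: psum_ge0; apply: nf_ge0.
Qed.

Lemma abs_summableX f n : abs_summable f -> abs_summable (f ^+ n).
Proof.
move=> hf; elim: n => [|n IH]; first exact: abs_summable1.
by rewrite exprS; apply: abs_summableM.
Qed.

Lemma Zs_D f g : abs_summable f -> abs_summable g -> Zs (f + g) = Zs f + Zs g.
Proof.
move=> hf hg; apply: Zs_eq.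
have -> : psum (f + g) = (fun M => psum f M + psum g M) by apply/funext => M; rewrite psumD.
by apply: tendsD; apply: Zs_conv.
Qed.

Lemma Zs_C c f : abs_summable f -> Zs (fpsC c * f) = c * Zs f.
Proof.
move=> hf; apply: Zs_eq.
have -> : psum (fpsC c * f) = (fun M => c * psum f M) by apply/funext => M; rewrite psumC.
by apply: tendsM; [exact: tends_cst|exact: Zs_conv].
Qed.

Lemma abs_summableN f : abs_summable f -> abs_summable (- f).
Proof. by move=> hf; rewrite -mulN1r -(rmorph1 (@fpsC R[i])) -rmorphN; apply: abs_summableC. Qed.

Lemma Zs_B f g : abs_summable f -> abs_summable g -> Zs (f - g) = Zs f - Zs g.
Proof.
move=> hf hg; rewrite Zs_D //; last exact: abs_summableN.
by rewrite -[- g]mulN1r -(rmorph1 (@fpsC R[i])) -rmorphN Zs_C // mulN1r.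
Qed.

Lemma Zs_1 : Zs 1 = 1.
Proof.
apply: Zs_eq; apply: tendsS.
have -> : (fun M => psum (1 : fps R[i]) M.+1) = fun=> 1.
  by apply/funext => M; rewrite /psum big_ord_recl big1 ?addr0.
exact: tends_cst.
Qed.

Lemma Zs_0 : Zs 0 = 0.
Proof.
apply: Zs_eq; have -> : psum (0 : fps R[i]) = fun=> 0.
  by apply/funext => M; rewrite /psum big1.
exact: tends_cst.
Qed.

Lemma Zs_sum I (r : seq I) (F : I -> fps R[i]) : (forall i, abs_summable (F i)) ->
  Zs (\sum_(i <- r) F i) = \sum_(i <- r) Zs (F i).
Proof.
move=> h; elim: r => [|i r IH]; first by rewrite !big_nil Zs_0.
by rewrite !big_cons Zs_D ?IH //; apply: abs_summable_sum.
Qed.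

(* The error of the Cauchy product is dominated by the error for the absolute
   values, where it is squeezed by the partial sums at M and at 2 M. *)
Lemma Zs_M f g : abs_summable f -> abs_summable g -> Zs (f * g) = Zs f * Zs g.
Proof.
move=> hf hg; apply: Zs_eq.
set a := nf f; set b := nf g.
have a0 m : 0 <= a m by apply: nf_ge0.
have b0 m : 0 <= b m by apply: nf_ge0.
have ab0 m : 0 <= (a * b) m by apply: sumr_ge0 => i _; apply: mulr_ge0.
have [A hA] := hf; have [B hB] := hg.
have /cvg_ex[/= la hla] := psum_bounded_cvg a0 hA.
have /cvg_ex[/= lb hlb] := psum_bounded_cvg b0 hB.
have hAB M : psum (a * b) M <= A * B.
  apply: le_trans (psum_mul_le _ a0 b0) _.
  by apply: ler_pM => //; apply: psum_ge0.
have /cvg_ex[/= lab hlab] := psum_bounded_cvg ab0 hAB.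
have hmul : (fun M => psum a M * psum b M) @ \oo --> la * lb by apply: cvgM.
have lE : la * lb = lab.
  apply/eqP; rewrite eq_le; apply/andP; split.
    apply: (@ler_cvg_to _ _ _ _ _ (fun M => psum (a * b) (M * 2)%N) _ _ hmul).
      by apply: (cvg_comp _ (psum (a * b)) _ hlab); apply: cvg_mulnr.
    by near=> M; apply: psum_mul_ge.
  apply: (ler_cvg_to hlab hmul).
  by near=> M; apply: psum_mul_le.
have herr : (fun M => psum a M * psum b M - psum (a * b) M) @ \oo --> (0 : R).
  by rewrite -[0](subrr lab) -{1}lE; apply: cvgB.
have hdiff M : nrm (psum f M * psum g M - psum (f * g) M) <=
    psum a M * psum b M - psum (a * b) M.
  have tail k : (k <= M)%N -> nrm (psum g M - psum g k) <= psum b M - psum b k.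
    move=> /subnK <-; elim: (M - k)%N => [|i IH]; first by rewrite add0n !subrr nrm0.
    rewrite addSn !psumS !(addrAC _ _ (- _)).
    by apply: le_trans (nrmD _ _) _; rewrite lerD.
  rewrite !psumM {1 3}/psum !mulr_suml -!sumrB.
  apply: le_trans (nrm_sum _ _) _; apply: ler_sum => i _.
  by rewrite -!mulrBr nrmM ler_wpM2l ?nrm_ge0 // tail // leq_subr.
have hz : tends (fun M => psum f M * psum g M - psum (f * g) M) 0.
  apply/cvgrPdist_lt => -[e e']; rewrite ltcE /= => /andP[/eqP -> e0].
  have /cvgrPdist_lt/(_ _ e0) := herr; apply: filterS => M.
  rewrite !sub0r normrN ger0_norm; last by rewrite subr_ge0 psum_mul_le.
  move=> hM; rewrite normrN nrmE ltcE /= eqxx /=.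
  exact: le_lt_trans (hdiff M) hM.
have h1 := tendsM (Zs_conv hf) (Zs_conv hg).
have := tendsD h1 (tendsM (@tends_cst (-1)) hz); rewrite mulr0 addr0.
by apply: tends_ext => M _; ring.
Unshelve. all: by end_near.
Qed.

End ComplexLimits.

(** * The congruence *)

Lemma geometric_psum_le (R : realType) (t : R) M : 0 <= t -> t < 1 ->
  \sum_(i < M) t ^+ i <= (1 - t)^-1.
Proof.
move=> t0 t1; have t1' : 0 < 1 - t by rewrite subr_gt0.
rewrite -[X in _ <= X]mul1r ler_pdivlMr //.
have -> : (\sum_(i < M) t ^+ i) * (1 - t) = 1 - t ^+ M.
  by rewrite -[RHS]opprB subrX1 -mulNr opprB mulrC.
by rewrite gerBl exprn_ge0.
Qed.

Lemma geometric_psum_le_last (R : realType) (t : R) M : 1 < t ->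
  \sum_(i < M) t ^+ i <= (t - 1)^-1 * t ^+ M.
Proof.
move=> t1; have t1' : 0 < t - 1 by rewrite subr_gt0.
rewrite mulrC ler_pdivlMr // mulrC -subrX1.
by rewrite gerBl ler01.
Qed.

Section Main.
Variables (R : realType) (q : R[i]).
Hypotheses (q_gt0 : 0 < nrm q) (q_lt1 : nrm q < 1).
Local Notation K := (R[i]).
Local Notation C := ((R[i])^o).
Implicit Types (f : fps K) (ks : seq nat).

Lemma nrm_qX_lt1 m : (0 < m)%N -> nrm (q ^+ m) < 1.
Proof. by move=> m0; rewrite nrmX exprn_ilt1 ?nrm_ge0 // -lt0n. Qed.

Lemma q_torsion m : (0 < m)%N -> q ^+ m != 1.
Proof.
move=> /nrm_qX_lt1; apply: contraTneq => ->.
by rewrite nrm1 ltxx.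
Qed.

Lemma xcoef_bound : exists X : R, 0 <= X /\ forall m, nrm (xcoef q m) <= X * nrm q ^+ m.
Proof.
have d0 : 0 < 1 - nrm q by rewrite subr_gt0.
exists (nrm (1 - q) / (1 - nrm q)); split; first by rewrite divr_ge0 ?nrm_ge0 // ltW.
case=> [|m]; first by rewrite xcoef0 nrm0 mulr_ge0 ?divr_ge0 ?nrm_ge0 ?exprn_ge0 // ltW.
rewrite /xcoef !nrmM nrmX nrmV nrmM nrmV invfM invrK mulrC.
rewrite ler_wpM2r ?exprn_ge0 ?nrm_ge0 // mulrC ler_wpM2l ?nrm_ge0 //.
have h : 1 - nrm q <= nrm (1 - q ^+ m.+1).
  apply: le_trans (nrmB_ge _ _); rewrite nrm1 lerD2l lerN2 nrmX.
  by rewrite exprS ger_pMr // exprn_ile1 ?nrm_ge0 // ltW.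
by rewrite lef_pV2 // posrE //; apply: lt_le_trans h.
Qed.

(* Any rate strictly between 1 and 1/|q| works. *)
Let rho : R := (1 + (nrm q)^-1) / 2.

Let rho_gt1 : 1 < rho.
Proof.
have : 1 < (nrm q)^-1 by rewrite invf_gt1.
by rewrite /rho => h; lra.
Qed.

Let rho_q : rho * nrm q < 1.
Proof.
rewrite /rho mulrAC mulrDl mul1r mulVf ?gt_eqF //.
by move: q_lt1 => h; lra.
Qed.

(** The letter b replaces coefficients by partial sums, and for rho > 1 the partial sums of rho^i
    are again O(rho^m); the letter a only multiplies by the bounded factors [xcoef q m]. So one rate
    serves all words. *)
Lemma Jop_bound ks : exists B : R, 0 <= B /\ forall m, nrm (Jop q ks 1 m) <= B * rho ^+ m.
Proof.
have [X [X0 hX]] := xcoef_bound.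
have rho0 : 0 <= rho by apply: ltW; apply: lt_trans rho_gt1.
elim: ks => [|k ks [B [B0 hB]]].
  exists 1; split=> // m; rewrite mul1r /=; case: m => [|m].
    by rewrite fps1E nrm1.
  by rewrite fps1E nrm0 exprn_ge0.
have h0 : 0 <= (rho - 1)^-1 by rewrite invr_ge0 subr_ge0 ltW.
exists (X ^+ k * (B * (rho - 1)^-1)); split; first by rewrite !mulr_ge0 ?exprn_ge0.
move=> m /=; rewrite iter_opa nrmM nrmX -mulrA ler_pM ?exprn_ge0 ?nrm_ge0 //.
  apply: lerXn2r; rewrite ?nnegrE ?nrm_ge0 //; apply: le_trans (hX m) _.
  by rewrite ler_piMr // exprn_ile1 ?nrm_ge0 // ltW.
rewrite fpsbME; apply: le_trans (nrm_sum _ _) _.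
apply: (@le_trans _ _ (\sum_(i < m) B * rho ^+ i)).
  by apply: ler_sum => i _; apply: hB.
by rewrite -mulr_sumr -mulrA ler_wpM2l // geometric_psum_le_last.
Qed.

(** The outermost a contributes a factor of order |q|^m, which beats rho^m because rho |q| < 1. *)
Lemma abs_summable_word k ks : abs_summable (Jop q (k.+1 :: ks) 1).
Proof.
have [X [X0 hX]] := xcoef_bound.
have [B [B0 hB]] := Jop_bound (k :: ks).
have t0 : 0 <= rho * nrm q.
  by rewrite mulr_ge0 ?nrm_ge0 // ltW // (lt_trans _ rho_gt1).
exists (X * B * (1 - rho * nrm q)^-1) => M.
apply: le_trans (_ : X * B * \sum_(i < M) (rho * nrm q) ^+ i <= _); last first.
  by rewrite ler_wpM2l ?mulr_ge0 // geometric_psum_le.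
rewrite mulr_sumr; apply: ler_sum => m _.
rewrite /nf /= -/(Jop q (k :: ks) 1) /opa nrmM.
have -> : X * B * (rho * nrm q) ^+ m = (X * nrm q ^+ m) * (B * rho ^+ m).
  by rewrite exprMn; ring.
by apply: ler_pM; rewrite ?nrm_ge0 //; exact: hB.
Qed.

(** * Z_q and N_q in terms of sums of power series *)

Definition cvp (x : lmono) : bool := (x.2 == [::]) || (1 <= head 0%N x.2)%N.

Lemma sp_summable f : sp q cvp f -> abs_summable f.
Proof.
move=> [p hp ->]; elim: p hp => [_|x p IH /= /andP[hx /IH hp]].
  by rewrite big_nil; exact: abs_summable0.
rewrite big_cons; apply: abs_summableD => //; apply: abs_summableC.
case: x hx => c [|[|k] ks] //= _; first exact: abs_summable1.
exact: abs_summable_word.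
Qed.

Lemma nq_cvp f : sp q nq f -> sp q cvp f.
Proof.
apply: sp_sub => x; rewrite /cvp => /orP[/and4P[_ -> _ _]|/andP[-> _]] //.
by rewrite orbT.
Qed.

Lemma foldl_wparse w f :
  foldl (opl q) f w = Jop q (rev (wparse w).2) (iter (wparse w).1 (opa q) f).
Proof.
elim: w f => [//|[] w IH] f; rewrite [foldl _ _ _]/= IH [wparse (_ :: _)]/=.
  by rewrite -iterSr.
by rewrite rev_cons -cats1 Jop_cat.
Qed.

Lemma Ssum_Js ks M : (0 < M)%N -> Ssum q ks M = Js q ks M.
Proof.
elim: ks M => [|k ks IH] [//|M] _; first by rewrite Js_nil.
rewrite Js_cons -(big_mkord xpredT (fun m => xcoef q m ^+ k * Js q ks m)).
rewrite [RHS]big_ltn // Js0 mulr0 add0r /=.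
by apply: eq_big_nat => m /andP[m0 _]; rewrite IH // mulrC.
Qed.

Lemma ZqM_psum p M : (0 < M)%N -> ZqM q M p = psum (Hop q p 1) M.
Proof.
move=> M0; rewrite /Hop psum_sum; apply: eq_bigr => x _.
rewrite psumC /ZqM_mono foldl_wparse.
case: (wparse x.2) => -[|n] ks /=.
  by rewrite Ssum_Js.
have h1 : opa q 1 = 0.
  apply/funext => -[|m]; first exact: opa0.
  by rewrite /opa fps1E mulr0.
rewrite -iterS iterSr h1 (linop0 (linop_iter n (linop_opa q))) (linop0 (linop_Jop q _)).
by rewrite /psum big1 ?mulr0.
Qed.

Lemma Zq_Hop p : abs_summable (Hop q p 1) -> Zq q p = Zs (Hop q p 1).
Proof.
move=> /Zs_conv h; apply: tends_lim; apply: tends_ext h => M M0.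
by rewrite ZqM_psum.
Qed.

Lemma Nq_sp f : sp q nq f -> Nq q (Zs f).
Proof.
move=> hf; have [p hp fE] := hf; exists (toh p); split.
  rewrite all_map; apply: sub_all hp => -[c ks] /=.
  by rewrite (n_monoE _ (wparse_rw ks)).
have E : f = Hop q (toh p) 1 by rewrite Hop_toh fE.
by rewrite Zq_Hop -E //; apply: sp_summable; apply: nq_cvp.
Qed.

Lemma NqP z : Nq q z -> exists2 f, sp q nq f & z = Zs f.
Proof.
move=> [p [hp ->]].
have h : sp q nq (Hop q p 1).
  elim: p hp => [_|x p IH /= /andP[hx /IH hp]]; first by rewrite /Hop big_nil; exact: sp0.
  rewrite /Hop big_cons; apply: spD => //; rewrite foldl_wparse.
  have w0 : (wparse x.2).1 = 0%N.
    by move: hx; rewrite /n_mono => /orP[/and5P[/eqP]|/and3P[/eqP]].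
  rewrite w0 /=; apply: (@sp_mono _ q nq (x.1, rev (wparse x.2).2)).
  rewrite -(@n_monoE x.1 x.2); first by case: x hx {w0}.
  by rewrite revK -w0; case: (wparse _).
exists (Hop q p 1) => //.
by rewrite Zq_Hop //; apply: sp_summable; apply: nq_cvp.
Qed.

(** * Stability of N_q under multiplication *)

Lemma Nq0 : Nq q 0.
Proof. by have := Nq_sp (sp0 q nq); rewrite Zs_0. Qed.

Lemma NqD x y : Nq q x -> Nq q y -> Nq q (x + y).
Proof.
move=> /NqP[f hf ->] /NqP[f' hf' ->].
rewrite -Zs_D; [|exact: sp_summable (nq_cvp hf)|exact: sp_summable (nq_cvp hf')].
by apply: Nq_sp; apply: spD.
Qed.

Lemma Nq_sum I (r : seq I) (F : I -> K) : (forall i, Nq q (F i)) -> Nq q (\sum_(i <- r) F i).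
Proof. by move=> h; elim/big_ind: _ => //; [exact: Nq0|exact: NqD]. Qed.

(** These multipliers are closed under sums and products, so it is enough to treat rational numbers
    and the values Z_q(g_n). *)
Definition Nq_mult (z : K) := forall x : K, Nq q x -> Nq q (z * x : K).

Lemma Nq_mult_rat (r : rat) : Nq_mult (ratr r).
Proof.
move=> x /NqP[f hf ->]; rewrite -(hevalC q).
rewrite -Zs_C; last exact: sp_summable (nq_cvp hf).
by apply: Nq_sp; apply: nq_scale.
Qed.

Lemma Nq_multD x y : Nq_mult x -> Nq_mult y -> Nq_mult (x + y).
Proof. by move=> hx hy z hz; rewrite mulrDl; apply: NqD; [exact: hx|exact: hy]. Qed.
Lemma Nq_multM x y : Nq_mult x -> Nq_mult y -> Nq_mult (x * y).
Proof. by move=> hx hy z hz; rewrite -mulrA; apply: hx; apply: hy. Qed.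
Lemma Nq_mult0 : Nq_mult 0.
Proof. by move=> x _; rewrite mul0r; exact: Nq0. Qed.
Lemma Nq_mult1 : Nq_mult 1.
Proof. by move=> x; rewrite mul1r. Qed.
Lemma Nq_mult_sum I (r : seq I) (F : I -> K) :
  (forall i, Nq_mult (F i)) -> Nq_mult (\sum_(i <- r) F i).
Proof. by move=> h; elim/big_ind: _ => //; [exact: Nq_mult0|exact: Nq_multD]. Qed.
Lemma Nq_multN1X n : Nq_mult ((-1) ^+ n).
Proof.
have -> : (-1) ^+ n = ratr ((-1) ^+ n) :> K by rewrite rmorphXn rmorphN rmorph1.
exact: Nq_mult_rat.
Qed.
Lemma Nq_mult_natV n : Nq_mult (n%:R^-1).
Proof.
have -> : n%:R^-1 = ratr (n%:R^-1) :> K by rewrite fmorphV rmorph_nat.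
exact: Nq_mult_rat.
Qed.

Lemma NqB x y : Nq q x -> Nq q y -> Nq q (x - y : K).
Proof.
move=> hx hy; apply: NqD => //; rewrite -mulN1r.
by have := Nq_multN1X 1; rewrite expr1; apply.
Qed.

Definition pz n : K := Zs (Jop q [:: n] 1).

Lemma Zs_stuffle n x : (0 < n)%N -> cvp x ->
  Zs (evmono q x) * pz n = \sum_(r <- stuffle1 n x.2) Zs (evmono q (x.1, r)).
Proof.
case: n => // n _ hx.
have hs r : (1 <= head 0%N r)%N || (r == [::]) -> abs_summable (Jop q r 1).
  by case: r => [_|[|k] r //= _]; [exact: abs_summable1|exact: abs_summable_word].
have hst : forall r, r \in stuffle1 n.+1 x.2 -> abs_summable (Jop q r 1).
  by move=> r hr; apply: hs; rewrite (@stuffle1_head n.+1 x.2).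
have hx' : abs_summable (Jop q x.2 1) by apply: hs; rewrite orbC.
rewrite Zs_C // -mulrA.
rewrite (eq_big_seq (fun r => heval q x.1 * Zs (Jop q r 1))); last first.
  by move=> r /hst hr; rewrite Zs_C.
rewrite -mulr_sumr; congr (_ * _).
have h1 := tendsM (Zs_conv hx') (Zs_conv (hs [:: n.+1] isT)).
apply: (tends_unique h1).
have : tends (fun M => \sum_(r <- stuffle1 n.+1 x.2) psum (Jop q r 1) M)
    (\sum_(r <- stuffle1 n.+1 x.2) Zs (Jop q r 1)).
  elim: (stuffle1 _ _) hst => [_|r rs IH h].
    rewrite big_nil; apply: (@tends_ext _ (fun=> 0)); last exact: tends_cst.
    by move=> M _; rewrite big_nil.
  rewrite big_cons.
  have h2 := tendsD (Zs_conv (h r (mem_head _ _)))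
    (IH (fun r' hr' => h r' (mem_behead (s := r :: rs) hr'))).
  by apply: tends_ext h2 => M _; rewrite big_cons.
by apply: tends_ext => M _; symmetry; exact: (@Js_stuffle _ q n.+1 x.2 M).
Qed.

Lemma Nq_mult_pz n : (0 < n)%N -> Nq_mult (pz n).
Proof.
move=> n0 x /NqP[f [p hp ->] ->].
elim: p hp => [_|y p IH /= /andP[hy hp]].
  by rewrite big_nil Zs_0 mulr0; exact: Nq0.
have sy : sp q nq (evmono q y) by apply: sp_mono.
have sP : sp q nq (\sum_(x <- p) evmono q x) by exists p.
rewrite big_cons Zs_D ?mulrDr; [|exact: sp_summable (nq_cvp sy)|exact: sp_summable (nq_cvp sP)].
apply: NqD; last exact: IH.
rewrite mulrC Zs_stuffle //; last first.
  by move: hy; rewrite /cvp => /orP[/and4P[_ -> _ _]|/andP[-> _]] //; rewrite orbT.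
rewrite big_seq; elim/big_ind: _ => [||r hr]; [exact: Nq0|exact: NqD|].
apply: Nq_sp; apply: sp_mono; apply: stuffle1_nq hr => //.
Qed.

Lemma Nq_mult_fpsM (F G : fps K) : (forall n, Nq_mult (F n)) -> (forall n, Nq_mult (G n)) ->
  forall n, Nq_mult ((F * G) n).
Proof. by move=> hF hG n; apply: Nq_mult_sum => i; apply: Nq_multM. Qed.

Lemma Nq_fpsM (F G : fps K) : (forall n, Nq_mult (F n)) -> (forall n, Nq q (G n)) ->
  forall n, Nq q ((F * G) n).
Proof. by move=> hF hG n; apply: Nq_sum => i; apply: hF. Qed.

(** * Generating series of values and the final comparison *)

Definition ZsX (F : fps (fps K)) : fps K := fun n => Zs (F n).

Lemma Zs_fpsM (F G : fps (fps K)) : (forall n, abs_summable (F n)) ->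
  (forall n, abs_summable (G n)) ->
  forall n, Zs ((F * G) n) = (ZsX F * ZsX G) n.
Proof.
move=> hF hG n; rewrite fpsME Zs_sum => [|i]; last exact: abs_summableM.
by apply: eq_bigr => i _; rewrite Zs_M.
Qed.

Lemma ps_expE (A : nat -> C) : ps_exp A = pexp (A : fps K).
Proof.
apply/funext => N; apply: eq_bigr => j _; congr (_ * _).
have -> : ps_pow A j = (A : fps K) ^+ j; last by [].
by elim: (j : nat) => [|i IH] //; rewrite exprS -IH.
Qed.

Definition ez : fps K := ZsX (A1 q).
Definition vz : fps K := ZsX (fexp (opL q)).
(** The logarithmic derivative of [ez], obtained as the limit of the finite Newton identities. *)
Definition nz : fps K := fun n => (-1) ^+ n * pz n.+1.

Lemma A1_summable n : abs_summable (A1 q n).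
Proof. by case: n => [|n]; [exact: abs_summable1|exact: abs_summable_word]. Qed.

Lemma opL_summable : abs_summable (opL q).
Proof. by have := A1_summable 1; rewrite /A1 /= mulr1. Qed.

Lemma fexp_summable n : abs_summable (fexp (opL q) n).
Proof. by apply: abs_summableC; apply: abs_summableX; exact: opL_summable. Qed.

Lemma Zq_g n : (0 < n)%N -> Zq q (g n) = pz n.
Proof.
case: n => // n _.
have E : Hop q (g n.+1) 1 = Jop q [:: n.+1] 1.
  by have := Hop_gk q [:: n.+1] 1; rewrite /gk /= Hop_mul Hop_one.
by rewrite Zq_Hop E //; exact: abs_summable_word.
Qed.

Lemma ez_deriv : fps_deriv ez = nz * ez.
Proof.
apply/funext => n; rewrite fpsME /fps_deriv.
have hl : tends (fun M => elemS q M n.+1 *+ n.+1) (ez n.+1 *+ n.+1).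
  rewrite -[_ *+ n.+1]mulr_natl.
  have := tendsM (@tends_cst _ n.+1%:R) (Zs_conv (A1_summable n.+1)).
  by apply: tends_ext => M _; rewrite mulr_natl.
apply: (tends_unique hl).
have hr : tends (fun M => \sum_(i < n.+1) newtonS q M i * elemS q M (n - i)%N)
    (\sum_(i < n.+1) (-1) ^+ i * pz i.+1 * ez (n - i)%N).
  apply: tends_sum => i; apply: tendsM; last exact: Zs_conv (A1_summable _).
  apply: tendsM; first exact: tends_cst.
  by apply: Zs_conv; exact: abs_summable_word.
apply: tends_ext hr => M M0.
by rewrite -[RHS]/(fps_deriv (elemS q M) n) newton.
Qed.

Lemma vzE n : vz n = n`!%:R^-1 * pz 1 ^+ n.
Proof.
rewrite /vz /ZsX /fexp Zs_C; last by apply: abs_summableX; exact: opL_summable.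
congr (_ * _); elim: n => [|n IH]; first exact: Zs_1.
rewrite !exprS Zs_M ?IH; [|exact: opL_summable|apply: abs_summableX; exact: opL_summable].
by rewrite /pz /= mulr1.
Qed.

Lemma vz_deriv : fps_deriv vz = fpsC (pz 1) * vz.
Proof.
apply/funext => n; rewrite fpsCM /fps_deriv !vzE factS natrM invfM exprS.
rewrite -mulrnAl -mulrnAl -[_^-1 *+ _]mulr_natr mulVf ?pnatr_eq0 // mul1r.
by rewrite mulrCA.
Qed.

(** Both sides have constant term 1 and logarithmic derivative [nz]. Its constant coefficient
    Z_q(g_1), which [Pser] omits, is supplied by [vz], the exponential of Z_q(g_1) X. *)
Lemma ezE : ez = pexp (Pser q : fps K) * vz.
Proof.
have P0 : (Pser q : fps K) 0%N = 0 by [].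
apply: (@fps_ode_uniq _ nz).
- exact: mulrSn_inj.
- exact: ez_deriv.
- rewrite fps_derivM pexp_deriv // vz_deriv.
  have -> : nz = fps_deriv (Pser q : fps K) + fpsC (pz 1).
    apply/funext => -[|n]; rewrite fpsDE /fps_deriv.
      by rewrite /Pser /= mul0rn add0r /nz mul1r.
    rewrite /fpsC /= addr0 /Pser /= Zq_g // -mulrnAl -mulrnAr.
    by rewrite -[_^-1 *+ _]mulr_natr mulVf ?pnatr_eq0 // mulr1.
  by ring.
rewrite /ez /ZsX /A1 /= Zs_1 fpsME big_ord1 vzE fact0 invr1 mul1r expr0 mulr1.
by rewrite /pexp big_ord1 fact0 invr1 mul1r expr0.
Qed.

Lemma Nq_mult_Pser n : Nq_mult (Pser q n).
Proof.
rewrite /Pser; case: ifP => [n2|_]; last exact: Nq_mult0.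
rewrite Zq_g; last exact: ltnW.
apply: Nq_multM; last by apply: Nq_mult_pz; apply: ltnW.
by apply: Nq_multM; [exact: Nq_multN1X|exact: Nq_mult_natV].
Qed.

Lemma Nq_mult_pexp n : Nq_mult (pexp (Pser q : fps K) n).
Proof.
have hX i m : Nq_mult (((Pser q : fps K) ^+ i) m).
  elim: i m => [|i IH] m.
    by rewrite expr0 fps1E; case: eqP => _; [exact: Nq_mult1|exact: Nq_mult0].
  by rewrite exprS; apply: Nq_mult_fpsM => // l; exact: Nq_mult_Pser.
by apply: Nq_mult_sum => j; apply: Nq_multM; [exact: Nq_mult_natV|exact: hX].
Qed.

(** [ezE] makes Z_q(g_1^n) a polynomial with rational coefficients in Z_q(g_1), Z_q(g_2), ..., so
    stability under the latter suffices. *)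
Lemma Nq_mult_ez n : Nq_mult (ez n).
Proof.
rewrite ezE; apply: Nq_mult_fpsM => m; first exact: Nq_mult_pexp.
rewrite vzE; apply: Nq_multM; first exact: Nq_mult_natV.
elim: m => [|m IH]; first exact: Nq_mult1.
by rewrite exprS; apply: Nq_multM => //; apply: Nq_mult_pz.
Qed.

Lemma lhs_serE ks n : abs_summable (Jop q (nseq n 1%N) (Jop q (rev ks) 1)) ->
  lhs_ser q ks n = Zs (Jop q (nseq n 1%N) (Jop q (rev ks) 1)).
Proof.
by move=> h; rewrite /lhs_ser Zq_Hop Hop_mul Hop_hpow_g1 Hop_gk.
Qed.

(** For the empty index there is no last letter a to write as P. The two sides are the values of A_1
    and A_2 themselves, and [ezE] gives an equality. *)
Lemma congruence_nil N : lhs_ser q [::] N - rhs_ser q [::] N = 0.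
Proof.
rewrite lhs_serE; last exact: A1_summable.
have E n : Eexp_ser q [::] n = vz n.
  have T1 : Tser q (Hop q (Ek [::]) 1) n = fexp (opL q) n.
    rewrite /Ek /= Hop_E10.
    by apply: T_one; [exact: Tser_lin|exact: Tser0|exact: (TserS q_torsion)].
  by rewrite /Eexp_ser Zq_Hop Hop_Ek_G T1 //; exact: fexp_summable.
have -> : rhs_ser q [::] N = (pexp (Pser q : fps K) * vz) N.
  by rewrite /rhs_ser ps_expE; apply: eq_bigr => i _; rewrite E.
by rewrite -ezE; exact: subrr.
Qed.

Lemma P_c_summable f (c : fps K) : sp q (kp false true) f -> sp q (kp false false) c ->
  abs_summable (opa q (f * c)).
Proof.
move=> hf hc; apply: sp_summable.
have := K_mul q_torsion hf hc; apply: sp_op; first exact: linop_opa.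
move=> [c0 [|k ks]] /andP[//= _ _].
by rewrite evmono_opa; apply: sp_mono.
Qed.

(* Modulo n, concatenation of g_k with either series A is A times the image of
   f c, c = c1 or c2; these differ by P of a multiple of hbar, hence by n. *)
Lemma congruence_cons ks : admissible ks -> ks != [::] ->
  forall N, Nq q (lhs_ser q ks N - rhs_ser q ks N).
Proof.
move=> hks hn; have [f [fE hf f0]] := admissible_opa q hks hn.
pose W (c : fps (fps K)) : fps (fps K) := opaX q (fpsC f * c).
have hc2 : spX q false (c2 q).
  apply: (fexp_sp q_torsion); apply: K_opp; apply: spD; first exact: opL_sp0.
  by have := hb_sp q; apply: K_weak.
have hc12 := c12_sp q_torsion.
have hc1 : spX q false (c1 q).
  move=> n; rewrite -[c1 q](subrK (c2 q)) fpsDE; apply: spD => //.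
  by have := hc12 n; apply: K_weak.
have sW c n : spX q false c -> abs_summable (W c n).
  by move=> hc; rewrite /W /opaX fpsCM; apply: P_c_summable.
pose w1 := ZsX (W (c1 q)).
pose w2 := ZsX (W (c2 q)).
have hw n : Nq q ((w1 - w2) n).
  rewrite fpsBE -Zs_B; [|exact: sW|exact: sW].
  rewrite /W /opaX !fpsCM -(linopB _ _ (linop_opa q)) -mulrBr.
  apply: Nq_sp; apply: nq_opa.
  exact: (K_mul q_torsion hf (hc12 n)).
have lhsE n : lhs_ser q ks n = (ez * w1) n.
  have E : Jop q (nseq n 1%N) (Jop q (rev ks) 1) = (A1 q * W (c1 q)) n.
    by rewrite fE (A1_shuffle q_torsion).
  rewrite lhs_serE E; last first.
    apply: abs_summable_sum => i; apply: abs_summableM; first exact: A1_summable.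
    exact: sW.
  by rewrite Zs_fpsM => // m; [exact: A1_summable|exact: sW].
pose rho_ (n : nat) := Tser q (Hop q (Ek ks) 1) n - Tser q (Jop q (rev ks) 1) n.
have hrho n : sp q nq (rho_ n) by exact: Ek_Tser.
have TE n : Tser q (Jop q (rev ks) 1) n = (fexp (opL q) * W (c2 q)) n.
  rewrite fE (T_shuffle q_torsion (T := Tser q)) //.
  - exact: Tser0.
  - exact: (TserS q_torsion).
have sT n : abs_summable ((fexp (opL q) * W (c2 q)) n).
  apply: abs_summable_sum => i; apply: abs_summableM; first exact: fexp_summable.
  exact: sW.
pose r := ZsX rho_.
have EE n : Eexp_ser q ks n = (vz * w2 + r) n.
  have E : Tser q (Hop q (Ek ks) 1) n = (fexp (opL q) * W (c2 q)) n + rho_ n.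
    by rewrite -TE addrC subrK.
  have sr : abs_summable (rho_ n) by apply: sp_summable; apply: nq_cvp.
  rewrite /Eexp_ser Zq_Hop Hop_Ek_G E; last exact: abs_summableD.
  rewrite Zs_D // Zs_fpsM => // m; [exact: fexp_summable|exact: sW].
move=> N; rewrite lhsE.
have -> : rhs_ser q ks N = (pexp (Pser q : fps K) * (vz * w2 + r)) N.
  by rewrite /rhs_ser ps_expE; apply: eq_bigr => i _; rewrite EE.
(* By [ezE] the exponential times [vz] is again [ez], so the main terms share this factor, and what
   remains is the difference [w1 - w2] and the error [r] from replacing E_k by g_k. *)
have -> : (ez * w1) N - (pexp (Pser q : fps K) * (vz * w2 + r)) N =
    (ez * (w1 - w2)) N - (pexp (Pser q : fps K) * r) N.
  by rewrite -!fpsBE; congr (_ N : K); rewrite ezE mulrDr mulrBr mulrA opprD addrA.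
apply: NqB; apply: Nq_fpsM => // m; [exact: Nq_mult_ez|exact: Nq_mult_pexp|].
by apply: Nq_sp.
Qed.

End Main.

Theorem theorem5p8 (R : realType) (q : R[i]) (hq0 : 0 < `|q|) (hq1 : `|q| < 1)
  (ks : seq nat) (hks : admissible ks) :
  forall N : nat, Nq q (lhs_ser q ks N - rhs_ser q ks N).
Proof.
have q_gt0 : 0 < nrm q by move: hq0; rewrite nrmE ltcR.
have q_lt1 : nrm q < 1 by move: hq1; rewrite nrmE ltcR.
have [->|hn] := eqVneq ks [::]; last exact: congruence_cons.
by move=> N; rewrite congruence_nil //; exact: Nq0.
Qed.
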